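(* Let $A$ be a strongly Koszul algebra and let $J=(m_1,\dots,m_r)$ be a monomial ideal of $A$ with $G(J)=\{m_1,\dots,m_r\}$, admitting linear quotients with respect to the given order, where $\deg(m_1)\leq\cdots\leq\deg(m_r)$. Then the iterated mapping cone derived from the sequence $m_1,\dots,m_r$ is a minimal graded free resolution of $A/J$, with basis elements in homological degree $\ell\geq1$ of the form $$\{m_i\otimes f\mid 1\leq i\leq r,\ f\text{ is a basis element of }(B^i_{\ell-1})^*\}.$$
   Context: Algebras. $k$ is a field; all $k$-algebras are commutative (except quadratic duals), finitely generated and standard graded. A $k$-algebra $A$ is Koszul if $k$ has a linear graded minimal free resolution over $A$. A Koszul algebra $A$ is strongly Koszul if there is a basis $X$ of $A_1$ such that for every $Y\subset X$ and every $x\in X\setminus Y$ there is $Z\subset X$ with $((Y):x)=(Z)$. By convention the presentation $A=k[x_1,\dots,x_n]/I$ is chosen so that $X=\{x_1,\dots,x_n\}$ (the ''variables''). Quadratic dual. Write $A=T(V)/Q$ with $V=A_1$, $T(V)$ the tensor algebra and $Q$ an ideal generated by quadrics. The quadratic dual is $A^!=T(V^* )/Q^\perp$, where $Q^\perp$ is generated by the orthogonal complement of $Q_2$ in $V^*\otimes V^*$ under the pairing $(v_1\otimes v_2)\otimes(u_1\otimes u_2)\mapsto u_1(v_1)u_2(v_2)$. The elements $x_1^*,\dots,x_n^*\in A^!_1$ form the basis dual to $x_1,\dots,x_n$. Monomial ideals. A monomial of $A$ is the class of a monomial in the variables. An ideal $J$ is a monomial ideal if, for a fixed chosen $k$-basis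 of $A$, its minimal generators can be written as monomials with respect to that basis; $G(J)=\{m_1,\dots,m_r\}$ is the set of (monic monomial) minimal generators. Put $J_i=(m_1,\dots,m_i)$, $J_0=(0)$. $J$ has linear quotients with respect to the given ordering if for all $2\leq i\leq r$ the ideal $(J_{i-1}:m_i)$ is generated by a subset of the variables. (Since $A$ is strongly Koszul, $(0:m_1)$ is also generated by a subset of the variables.) For $1\leq i\leq r$ write $(J_{i-1}:m_i)=(x_j\mid j\in E_i)$ with $E_i\subset\{1,\dots,n\}$, $L^i=\sum_{j\notin E_i}A^!x_j^*$ (a left ideal), $B^i=A^!/L^i$, and $(B^i_d)^*=\operatorname{Hom}_k(B^i_d,k)$. The space $(B^i)^*$ is a right $A^!$-module via $(\phi\cdot a)(b)=\phi(ab)$. Iterated mapping cone. Let $K^{(i)}_\bullet$ be the complex with $K^{(i)}_d=A\otimes_k(B^i_d)^*$ and differential $a\otimes\phi\mapsto\sum_s ax_s\otimes\phi x_s^*$, augmented to $A/(J_{i-1}:m_i)$. Put $F^{(0)}=A$ in homological degree $0$. Inductively, using the short exact sequence $0\to A/(J_{i-1}:m_i)\xrightarrow{\cdot m_i}A/J_{i-1}\to A/J_i\to0$, let $\psi^{(i)}:K^{(i)}_\bullet\to F^{(i-1)}_\bullet$ be a chain map lifting multiplication by $m_i$ (with the degree shift of $K^{(i)}$ by $\deg m_i$ making it homogeneous) and let $F^{(i)}_\bullet$ be the mapping cone of $\psi^{(i)}$. The iterated mapping cone derived from $m_1,\dots,m_r$ is $F^{(r)}_\bullet$. The symbol $m_i\otimes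 f$ in homological degree $\ell$ denotes the basis element coming from $1\otimes f\in K^{(i)}_{\ell-1}$, where $f$ runs over a chosen $k$-basis of $(B^i_{\ell-1})^*$. *)

(* Defs.v *)
From HB Require Import structures.
From mathcomp Require Import all_boot all_order all_algebra.
From mathcomp Require Import mpoly.

Set Implicit Arguments.
Unset Strict Implicit.
Unset Printing Implicit Defensive.

Import GRing.Theory.

Local Open Scope ring_scope.

Section Ideals.
Variables (k : fieldType) (A : comAlgType k).

Definition ideal_gen (I : finType) (P : pred I) (g : I -> A) : A -> Prop :=
  fun a => exists c : I -> A, a = \sum_(i | P i) c i * g i.

Definition colon (J : A -> Prop) (m : A) : A -> Prop := fun a => J (a * m).

Definition same_ideal (J J' : A -> Prop) : Prop := forall a, J a <-> J' a.

(* The ideal (Y) of a set Y of variables, Y being given by its indices. *)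
Definition var_ideal (n : nat) (x : 'I_n -> A) (Y : {set 'I_n}) : A -> Prop :=
  ideal_gen (mem Y) x.

(* The graded maximal ideal (x_1, ..., x_n). *)
Definition max_ideal (n : nat) (x : 'I_n -> A) : A -> Prop :=
  var_ideal x [set: 'I_n].

End Ideals.

Section Graded.
Variables (k : fieldType) (A : comAlgType k) (gr : nat -> A -> Prop).
Variables (n : nat) (x : 'I_n -> A).

(* A = \bigoplus_d A_d, with A_d = {a | gr d a}; A_0 = k, A_1 has basis x, and
   A_(d+1) = A_1 A_d. *)
Record standard_graded : Prop := StandardGraded {
  sg_zero : forall d, gr d 0;
  sg_linear : forall d (c : k) a b, gr d a -> gr d b -> gr d (c *: a + b);
  sg_one : forall a, gr 0 a <-> exists c : k, a = c%:A;
  sg_mul : forall d e a b, gr d a -> gr e b -> gr (d + e)%N (a * b);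
  sg_span : forall a, exists (N : nat) (b : nat -> A),
    (forall d, gr d (b d)) /\ a = \sum_(d < N) b d;
  sg_direct : forall (N : nat) (b : nat -> A), (forall d, gr d (b d)) ->
    \sum_(d < N) b d = 0 -> forall d, (d < N)%N -> b d = 0;
  sg_var : forall i, gr 1 (x i);
  sg_var_span : forall a, gr 1 a -> exists c : 'I_n -> k, a = \sum_i c i *: x i;
  sg_var_free : forall c : 'I_n -> k,
    \sum_i c i *: x i = 0 -> forall i, c i = 0;
  sg_gen : forall d a, gr d.+1 a ->
    exists b : 'I_n -> A, (forall i, gr d (b i)) /\ a = \sum_i x i * b i
}.

(* a is homogeneous of degree p - q, hence zero if p < q: the condition on the
   coefficient of a basis element of degree q in an element of degree p. *)
Definition homog_coef (p q : nat) (a : A) : Prop :=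
  if (q <= p)%N then gr (p - q) a else a = 0.

End Graded.

Section Complexes.
Variables (k : fieldType) (A : comAlgType k).

(* A sequence of free modules with an augmentation F_0 -> A, to be read modulo
   an ideal J. F_d consists of the row vectors of length rk d, the s-th standard
   basis vector having degree sh s, and maps act on row vectors from the right. *)
Record augcomplex := AugComplex {
  rk : nat -> nat;
  sh : forall d, 'I_(rk d) -> nat;
  dif : forall d, 'M[A]_(rk d.+1, rk d);
  aug : 'cV[A]_(rk 0)
}.

Variables (gr : nat -> A -> Prop) (n : nat) (x : 'I_n -> A).

Definition graded_complex (F : augcomplex) : Prop :=
  [/\ forall d s t, homog_coef gr (sh (d := d.+1) s) (sh (d := d) t) (dif F d s t),
      forall s, homog_coef gr (sh (d := 0) s) 0 (aug F s 0)
    & forall d, dif F d.+1 *m dif F d = 0].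

Definition resolves (F : augcomplex) (J : A -> Prop) : Prop :=
  [/\ forall a, exists v : 'rV[A]_(rk F 0), J (a - (v *m aug F) 0 0),
      forall v : 'rV[A]_(rk F 0),
        J ((v *m aug F) 0 0) <-> exists w, v = w *m dif F 0
    & forall d (v : 'rV[A]_(rk F d.+1)),
        v *m dif F d = 0 -> exists w, v = w *m dif F d.+1].

Definition minimal_complex (F : augcomplex) : Prop :=
  forall d s t, max_ideal x (dif F d s t).

Definition minimal_graded_free_resolution F (J : A -> Prop) : Prop :=
  [/\ graded_complex F, resolves F J & minimal_complex F].

Definition linear_complex (F : augcomplex) : Prop :=
  forall d (s : 'I_(rk F d)), sh s = d.

(* Finite ranks are no restriction: a minimal graded free resolution of a
   finitely generated graded A-module has finite rank in each degree. *)
Definition koszul : Prop :=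
  exists F, minimal_graded_free_resolution F (max_ideal x) /\ linear_complex F.

Definition strongly_koszul : Prop :=
  koszul /\
  forall (Y : {set 'I_n}) (i : 'I_n), i \notin Y ->
    exists Z : {set 'I_n}, same_ideal (colon (var_ideal x Y) (x i)) (var_ideal x Z).

Definition free_module_basis (T : finType) (N : nat) (e : T -> 'rV[A]_N) : Prop :=
  forall w, exists! c : {ffun T -> A}, w = \sum_t c t *: e t.

(* A in homological degree 0. *)
Definition base_complex : augcomplex :=
  {| rk := fun d => (d == 0)%N : nat;
     sh := fun _ _ => 0%N;
     dif := fun _ => 0;
     aug := const_mx 1 |}.

(* psi : K -> F is a homogeneous chain map lifting A/(J : m) --m--> A/J. *)
Definition lifts_mul (K F : augcomplex) (J : A -> Prop) (m : A)
    (psi : forall d, 'M[A]_(rk K d, rk F d)) : Prop :=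
  [/\ forall d s t, homog_coef gr (sh (a := K) s) (sh (a := F) t) (psi d s t),
      forall d, psi d.+1 *m dif F d = dif K d *m psi d
    & forall v : 'rV[A]_(rk K 0),
        J ((v *m psi 0%N *m aug F) 0 0 - m * (v *m aug K) 0 0)].

Section Cone.
Variables (F K : augcomplex) (psi : forall d, 'M[A]_(rk K d, rk F d)).

Definition cone_rk (d : nat) : nat :=
  match d with 0 => rk F 0 | d'.+1 => rk F d'.+1 + rk K d' end.

Definition cone_sh (d : nat) : 'I_(cone_rk d) -> nat :=
  match d with
  | 0 => fun s => sh s
  | d'.+1 => fun s =>
      match split s with inl s1 => sh s1 | inr s2 => sh s2 end
  end.

Definition cone_dif (d : nat) : 'M[A]_(cone_rk d.+1, cone_rk d) :=
  match d with
  | 0 => col_mx (dif F 0) (psi 0)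
  | d'.+1 => block_mx (dif F d'.+1) 0 (psi d'.+1) (- dif K d')
  end.

Definition mapping_cone : augcomplex :=
  {| rk := cone_rk; sh := cone_sh; dif := cone_dif; aug := aug F |}.

End Cone.

Section IteratedCone.
Variable K : nat -> augcomplex.

(* psi j F is the chain map K_j -> F chosen when the complex built so far is F;
   only the value at F = iterated_cone psi j is ever used. *)
Variable psi : forall (j : nat) (F : augcomplex) d, 'M[A]_(rk (K j) d, rk F d).

Fixpoint iterated_cone (i : nat) : augcomplex :=
  match i with
  | 0 => base_complex
  | j.+1 => mapping_cone (psi j (iterated_cone j))
  end.

(* The image of v under (K_j)_l -> (iterated_cone j.+1)_(l+1) followed by the
   inclusions of the successive cones into iterated_cone i (zero if i <= j). *)
Fixpoint cone_incl (j l : nat) (v : 'rV[A]_(rk (K j) l)) (i : nat) :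
    'rV[A]_(rk (iterated_cone i) l.+1) :=
  match i with
  | 0 => 0
  | i'.+1 => row_mx (cone_incl v i') (if j == i' then conform_mx 0 v else 0)
  end.

End IteratedCone.
End Complexes.

Section QuotientSpace.
Variables (k : fieldType) (vT : vectType k) (U : {vspace vT}).

(* vT / U, carried by the chosen complement of U. *)
Definition quotv : vectType k := subvs_of U^C%VS.

Definition quotv_pi : 'Hom(vT, quotv) := linfun (vsproj U^C \o daddv_pi U^C U).

Definition quotv_repr : 'Hom(quotv, vT) := linfun (vsval (U := U^C)).

Lemma quotv_piE v : vsval (quotv_pi v) = daddv_pi U^C U v.
Proof. by rewrite lfunE /= vsprojK // memv_pi. Qed.

Lemma quotv_reprK b : quotv_pi (quotv_repr b) = b.
Proof.
apply: val_inj; rewrite /= quotv_piE lfunE /=.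
by rewrite daddv_pi_id ?subvsP // capvC capv_compl.
Qed.

Lemma quotv_pi_eq0 v : (quotv_pi v == 0) = (v \in U).
Proof.
rewrite -(inj_eq val_inj) /= quotv_piE.
have dir : (U^C :&: U = 0)%VS by rewrite capvC capv_compl.
have vD : v \in (U^C + U)%VS by rewrite addvC addv_complf memvf.
have defv := daddv_pi_add dir vD.
apply/eqP/idP => [v0 | Uv]; first by rewrite -defv v0 add0r memv_pi.
apply/eqP; rewrite -memv0 -dir memv_cap memv_pi /=.
by rewrite -[X in X \in _](addrK (daddv_pi U U^C v)) defv memvB ?memv_pi.
Qed.

End QuotientSpace.

Section QuadraticDual.
Variables (k : fieldType) (n : nat).

(* Degree d part of the tensor algebra on a space with basis indexed by 'I_n:
   t stands for the sum of t w times the tensor word w. It is used both for V,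
   with basis x_i, and for V^*, with the dual basis. *)
Definition tensor (d : nat) : vectType k := {ffun d.-tuple 'I_n -> k^o}.

Definition tensor_lmul_fun d (s : 'I_n) (t : tensor d) : tensor d.+1 :=
  [ffun w => if thead w == s then t [tuple of behead w] else 0].

Definition tensor_rmul_fun d (s : 'I_n) (t : tensor d) : tensor d.+1 :=
  [ffun w => if tnth w ord_max == s
             then t [tuple tnth w (widen_ord (leqnSn d) i) | i < d] else 0].

Lemma tensor_lmul_is_linear d s : linear (@tensor_lmul_fun d s).
Proof.
move=> c t u; apply/ffunP => w; rewrite !ffunE.
by case: ifP => _; rewrite ?ffunE ?scaler0 ?addr0.
Qed.

Lemma tensor_rmul_is_linear d s : linear (@tensor_rmul_fun d s).
Proof.
move=> c t u; apply/ffunP => w; rewrite !ffunE.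
by case: ifP => _; rewrite ?ffunE ?scaler0 ?addr0.
Qed.

HB.instance Definition _ d s := GRing.isLinear.Build k (tensor d) (tensor d.+1)
  *:%R (@tensor_lmul_fun d s) (@tensor_lmul_is_linear d s).
HB.instance Definition _ d s := GRing.isLinear.Build k (tensor d) (tensor d.+1)
  *:%R (@tensor_rmul_fun d s) (@tensor_rmul_is_linear d s).

(* Multiplication by the s-th basis vector on the left and on the right. *)
Definition tensor_lmul d s : 'Hom(tensor d, tensor d.+1) :=
  linfun (@tensor_lmul_fun d s).
Definition tensor_rmul d s : 'Hom(tensor d, tensor d.+1) :=
  linfun (@tensor_rmul_fun d s).

(* In dual bases, the pairing of V^* (x) V^* with V (x) V is the dot product. *)
Definition pairing_fun (q u : tensor 2) : k^o := \sum_w q w * u w.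

Lemma pairing_is_linear q : linear (pairing_fun q).
Proof.
move=> c u v; rewrite /pairing_fun scaler_sumr -big_split; apply: eq_bigr => w _.
by rewrite !ffunE mulrDr; congr (_ + _); rewrite mulrCA.
Qed.

HB.instance Definition _ q := GRing.isLinear.Build k (tensor 2) k^o
  *:%R (pairing_fun q) (pairing_is_linear q).

Definition perp (Q : {vspace tensor 2}) : {vspace tensor 2} :=
  (\bigcap_(q <- vbasis Q) lker (linfun (pairing_fun q)))%VS.

Variable Q2 : {vspace tensor 2}.

Definition dual_gens (d : nat) : {vspace tensor d} :=
  match d with 2 => perp Q2 | _ => 0%VS end.

(* Degree d part of the two-sided ideal generated by perp Q2. *)
Fixpoint dual_ideal (d : nat) : {vspace tensor d} :=
  match d with
  | 0 => 0%VS
  | d'.+1 => (dual_gens d'.+1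
              + \sum_(s < n) (tensor_lmul d' s @: dual_ideal d')
              + \sum_(s < n) (tensor_rmul d' s @: dual_ideal d'))%VS
  end.

(* A^!_d, with left and right multiplication by x_s^*. *)
Definition qdual (d : nat) : vectType k := quotv (dual_ideal d).

Definition qdual_lmul d (s : 'I_n) : 'Hom(qdual d, qdual d.+1) :=
  (quotv_pi (dual_ideal d.+1) \o tensor_lmul d s \o quotv_repr (dual_ideal d))%VF.
Definition qdual_rmul d (s : 'I_n) : 'Hom(qdual d, qdual d.+1) :=
  (quotv_pi (dual_ideal d.+1) \o tensor_rmul d s \o quotv_repr (dual_ideal d))%VF.

Definition qdual_one : qdual 0 := quotv_pi (dual_ideal 0) [ffun => 1].

Variable E : {set 'I_n}.

(* Degree d part of the left ideal L = \sum_(j \notin E) A^! x_j^*. *)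
Definition Lideal (d : nat) : {vspace qdual d} :=
  match d with
  | 0 => 0%VS
  | d'.+1 => (\sum_(j < n | j \notin E) limg (qdual_rmul d' j))%VS
  end.

(* B_d = (A^! / L)_d, its k-dual, and the right action of x_s^* on the duals. *)
Definition Bmod (d : nat) : vectType k := quotv (Lideal d).

Definition Bmod_lmul d (s : 'I_n) : 'Hom(Bmod d, Bmod d.+1) :=
  (quotv_pi (Lideal d.+1) \o qdual_lmul d s \o quotv_repr (Lideal d))%VF.

Definition Bmod_one : Bmod 0 := quotv_pi (Lideal 0) qdual_one.

Definition Bdual (d : nat) : vectType k := 'Hom(Bmod d, k^o).

Definition Bdual_act d (phi : Bdual d.+1) (s : 'I_n) : Bdual d :=
  (phi \o Bmod_lmul d s)%VF.

End QuadraticDual.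

Section Kcomplex.
Variables (k : fieldType) (A : comAlgType k) (n : nat) (x : 'I_n -> A).

(* Q2 is the kernel of V (x) V -> A_2, i.e. Q_2 where A = T(V) / Q. *)
Definition quadratic_relations (Q2 : {vspace tensor k n 2}) : Prop :=
  forall q : tensor k n 2,
    q \in Q2 <-> \sum_w q w *: (x (tnth w 0) * x (tnth w 1)) = 0.

(* A (x)_k W is the free A-module on the reference basis of W; this is the
   pure tensor a (x) w. *)
Definition pure_tensor (W : vectType k) (a : A) (w : W) : 'rV[A]_(\dim {:W}) :=
  \row_j (coord (vbasis {:W}) j w *: a).

Variables (Q2 : {vspace tensor k n 2}) (E : {set 'I_n}) (e : nat).

(* The complex A (x) (B_d)^*, generated in degrees d + e; its augmentation is
   a (x) phi |-> phi(1) a. *)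
Definition Kcomplex : augcomplex A :=
  {| rk := fun d => \dim {: Bdual Q2 E d};
     sh := fun d _ => (d + e)%N;
     dif := fun d => \matrix_(i < \dim {: Bdual Q2 E d.+1})
       \sum_(s < n) pure_tensor (x s) (Bdual_act (vbasis {: Bdual Q2 E d.+1})`_i s);
     aug := \col_(i < \dim {: Bdual Q2 E 0})
       ((vbasis {: Bdual Q2 E 0})`_i (Bmod_one Q2 E))%:A |}.

End Kcomplex.

Section MonomialIdeals.
Variables (k : fieldType) (A : comAlgType k) (n : nat) (x : 'I_n -> A).

(* The classes in A of the monomials in S form a k-basis of A. *)
Definition monomial_basis (S : pred 'X_{1..n}) : Prop :=
  (forall a : A, exists (s : seq 'X_{1..n}) (c : 'X_{1..n} -> k),
     all S s /\ a = \sum_(u <- s) c u *: mmap1 x u) /\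
  (forall (s : seq 'X_{1..n}) (c : 'X_{1..n} -> k), uniq s -> all S s ->
     \sum_(u <- s) c u *: mmap1 x u = 0 -> {in s, forall u, c u = 0}).

Variables (r : nat) (mu : r.-tuple 'X_{1..n}).

(* Indices start at 0: mon i and partial_ideal i are the (i+1)-st generator
   and the ideal generated by the first i generators. *)
Definition mon (i : nat) : A := mmap1 x (nth 0%MM mu i).

Definition mon_deg (i : nat) : nat := mdeg (nth 0%MM mu i).

Definition partial_ideal (i : nat) : A -> Prop :=
  ideal_gen (fun j : 'I_r => (j < i)%N) (fun j => mon j).

Definition minimal_generators : Prop :=
  forall i : 'I_r, ~ ideal_gen (predC1 i) (fun j : 'I_r => mon j) (mon i).

Definition linear_quotients : Prop :=
  forall i, (0 < i < r)%N -> exists Z : {set 'I_n},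
    same_ideal (colon (partial_ideal i) (mon i)) (var_ideal x Z).

Definition colon_vars (E : nat -> {set 'I_n}) : Prop :=
  forall i, (i < r)%N ->
    same_ideal (colon (partial_ideal i) (mon i)) (var_ideal x (E i)).

Variables (gr : nat -> A -> Prop) (Q2 : {vspace tensor k n 2}).

Definition KE (E : nat -> {set 'I_n}) (i : nat) : augcomplex A :=
  Kcomplex x Q2 (E i) (mon_deg i).

(* E and psi are admissible data for the iterated mapping cone. *)
Definition cone_data (E : nat -> {set 'I_n})
    (psi : forall j F d, 'M[A]_(rk (KE E j) d, rk F d)) : Prop :=
  colon_vars E /\
  forall j, (j < r)%N ->
    lifts_mul gr (partial_ideal j) (mon j) (psi j (iterated_cone psi j)).

End MonomialIdeals.

(* Main.v *)
Require Import Defs.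
From mathcomp Require Import all_boot all_order all_algebra.
From mathcomp Require Import mpoly ring.
From Stdlib Require Import ClassicalEpsilon.

(** The heart of the matter is a statement about the ring alone: for every set
    [Y] of variables, the complex [K(Y)] of free modules [A (x) (A^!/L_Y)_d^*],
    where [L_Y] is the left ideal of [A^!] generated by the [x_j^*] with [j] not
    in [Y], resolves [A/(Y)].

    An element of [K(Y)_d] is an [A]-valued function on the words of length [d]
    in the variables which is killed by the orthogonal of the relations of [A]
    at any two consecutive places and vanishes on the words whose last letter
    is not in [Y] ([koszul_tensor], and [row_tensor] for the translation). The
    differential strips the first letter of the words. If [Y] is the disjoint
    union of [Y'] and a variable [i], and if [(Y') : x_i = (Z)], stripping the
    last letter [i] instead gives a sequence of complexes

      0 -> K(Y') -> K(Y) -> K(Z)[-1] -> 0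

    which is visibly left exact, and whose map to [K(Z)] is well defined because
    the last two letters of an element of [K(Y)] form a relation of [A]
    ([koszul_tensor_strip]). Exactness of all the [K(Y)] and surjectivity on the
    right are proved together by induction on the homological degree: a preimage
    is built letter by letter from preimages one degree lower, corrected by means
    of the exactness of [K(Y')] ([koszul_liftableS]); and exactness of [K(Y)]
    follows by a diagram chase from that of [K(Z)] one degree lower and, by
    induction on the number of variables, that of [K(Y')] ([koszul_exactS]).

    Granted this, multiplication by [m_i] from [A/(J_(i-1) : m_i)] to
    [A/J_(i-1)] lifts to a homogeneous chain map ([comparison]), and the mapping
    cone of any such lift resolves the cokernel [A/J_i] ([cone_resolves]).
    Minimality is a matter of degrees: in homological degree [l + 1] the strand
    of [m_i] is generated in degree [l + 1 + deg m_i], while the cone built so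
    far is generated in degrees [l + deg m_j] with [j < i], which are strictly
    smaller since [deg m_j <= deg m_i]; in homological degree 0 one compares
    [deg m_i], which is positive as [J] is proper, with 0 ([cone_invariant]).
    Hence the entries of the lifts have positive degree. The asserted bases
    exist since each cone is the direct sum of the strands ([cone_proj]). *)

Set Implicit Arguments.
Unset Strict Implicit.
Unset Printing Implicit Defensive.

Import GRing.Theory.

Local Open Scope ring_scope.

(** * Homogeneous components *)

Lemma linear_sum_scale (R : nzRingType) (M N : lmodType R) (f : M -> N) :
  linear f -> forall (I : finType) (c : I -> R) (z : I -> M),
  f (\sum_i c i *: z i) = \sum_i c i *: f (z i).
Proof.
move=> lin_f I c z; elim/big_rec2: _ => [|i y1 y2 _ <-]; last exact: lin_f.
by have := lin_f (-1) 0 0; rewrite scaler0 addr0 scaleN1r addNr.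
Qed.

Section Components.
Variables (k : fieldType) (A : comAlgType k) (gr : nat -> A -> Prop).
Variables (n : nat) (x : 'I_n -> A).
Hypothesis sg : standard_graded gr x.

Lemma gr_add d a b : gr d a -> gr d b -> gr d (a + b).
Proof. by move=> ga gb; rewrite -[a]scale1r; apply: (sg_linear sg). Qed.

Lemma gr_scale d (c : k) a : gr d a -> gr d (c *: a).
Proof.
by move=> ga; rewrite -[c *: a]addr0; apply: (sg_linear sg) => //; apply: (sg_zero sg).
Qed.

Lemma gr_opp d a : gr d a -> gr d (- a).
Proof. by rewrite -scaleN1r; apply: gr_scale. Qed.

Lemma gr_sum d (I : finType) (P : pred I) (F : I -> A) :
  (forall i, P i -> gr d (F i)) -> gr d (\sum_(i | P i) F i).
Proof.
move=> gF; elim/big_ind: _ => //; first exact: (sg_zero sg).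
exact: gr_add.
Qed.

Lemma gr_scalar (c : k) : gr 0 c%:A.
Proof. by apply/(sg_one sg); exists c. Qed.

Lemma gr_monomial (u : 'X_{1..n}) : gr (mdeg u) (mmap1 x u).
Proof.
have grX i m : gr m (x i ^+ m).
  elim: m => [|m IHm]; first by rewrite expr0 -[1]scale1r; apply: gr_scalar.
  by rewrite exprS -add1n; apply: (sg_mul sg) => //; apply: (sg_var sg).
rewrite /mmap1 mdegE; elim/big_rec2: _ => [|i y a _ gy].
  by rewrite -[1]scale1r; apply: gr_scalar.
by apply: (sg_mul sg).
Qed.

Definition decomposes (a : A) (b : nat -> A) : Prop :=
  (forall d, gr d (b d)) /\
  exists N, (forall d, (N <= d)%N -> b d = 0) /\ a = \sum_(d < N) b d.

Lemma decomposes_ex a : exists b, decomposes a b.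
Proof.
have [N [b [gb ->]]] := sg_span sg a.
exists (fun d => if (d < N)%N then b d else 0); split=> [d|].
  by case: ifP => // _; apply: (sg_zero sg).
exists N; split=> [d|]; first by rewrite leqNgt => /negbTE ->.
by apply: eq_bigr => d _; rewrite ltn_ord.
Qed.

Lemma decomposes_widen a b N M : (forall d, (N <= d)%N -> b d = 0) ->
  a = \sum_(d < N) b d -> (N <= M)%N -> a = \sum_(d < M) b d :> A.
Proof.
move=> b0 -> leNM; rewrite -!(big_mkord xpredT b) [RHS](big_cat_nat (n := N)) //=.
by rewrite [X in _ = _ + X]big_nat [X in _ = _ + X]big1 ?addr0 // => d /andP[/b0].
Qed.

Lemma decomposes_uniq a b b' : decomposes a b -> decomposes a b' -> b =1 b'.
Proof.
move=> [gb [N [b0 ab]]] [gb' [N' [b0' ab']]] d.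
pose M := maxn d.+1 (maxn N N').
have leN : (N <= M)%N by rewrite /M !leq_max leqnn orbT.
have leN' : (N' <= M)%N by rewrite /M !leq_max leqnn !orbT.
apply/eqP; rewrite -subr_eq0; apply/eqP.
apply: (sg_direct sg (N := M) (b := fun d => b d - b' d)) => [e||].
- by apply: gr_add => //; apply: gr_opp.
- by rewrite sumrB -(decomposes_widen b0 ab) // -(decomposes_widen b0' ab') ?subrr.
- by rewrite /M leq_max leqnn.
Qed.

(** The grading is given by predicates on [A], so its projections are obtained
    by choice; uniqueness of decompositions makes them linear. *)
Definition component (d : nat) (a : A) : A :=
  epsilon (inhabits (fun _ => 0)) (decomposes a) d.

Lemma componentP a : decomposes a (component^~ a).
Proof. exact: (epsilon_spec (inhabits (fun _ => 0)) (decomposes a) (decomposes_ex a)). Qed.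

Lemma componentE a b d : decomposes a b -> component d a = b d.
Proof. by move=> ab; apply: (decomposes_uniq (componentP a) ab). Qed.

Lemma gr_component d a : gr d (component d a).
Proof. by case: (componentP a). Qed.

Lemma component_linear d : linear (component d).
Proof.
move=> c a a'; pose b d := c *: component d a + component d a'.
rewrite (@componentE _ b) //; split=> [e|].
  by apply: (sg_linear sg); apply: gr_component.
have [_ [N [z zE]]] := componentP a; have [_ [N' [z' zE']]] := componentP a'.
exists (maxn N N'); split=> [e|].
  by rewrite geq_max => /andP[/z e0 /z' e0']; rewrite /b e0 e0' scaler0 addr0.
rewrite big_split -scaler_sumr -(decomposes_widen z zE) ?leq_maxl //.
by rewrite -(decomposes_widen z' zE') ?leq_maxr.
Qed.

Lemma component_sum d (I : finType) (P : pred I) (F : I -> A) :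
  component d (\sum_(i | P i) F i) = \sum_(i | P i) component d (F i).
Proof.
rewrite big_mkcond [RHS]big_mkcond /=.
have -> : \sum_i (if P i then F i else 0) = \sum_i (P i)%:R *: F i :> A.
  by apply: eq_bigr => i _; case: (P i); rewrite ?scale1r ?scale0r.
rewrite linear_sum_scale; last exact: component_linear.
by apply: eq_bigr => i _; case: (P i); rewrite ?scale1r ?scale0r.
Qed.

Lemma component_mul i j a b : gr j b ->
  component i (a * b) = if (j <= i)%N then component (i - j) a * b else 0.
Proof.
move=> gb; have [ga [N [z aE]]] := componentP a.
pose c i := if (j <= i)%N then component (i - j) a * b else 0.
apply: (componentE (b := c)); split=> [e|].
  rewrite /c; case: ifP => le_je; last exact: (sg_zero sg).
  by rewrite -[X in gr X _](subnK le_je); apply: (sg_mul sg); first exact: gr_component.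
exists (j + N)%N; split=> [e le_e|].
  rewrite /c (leq_trans (leq_addr N j) le_e) z ?mul0r //.
  by rewrite leq_subRL // (leq_trans (leq_addr N j)).
rewrite big_split_ord /= big1 ?add0r => [|e _]; last first.
  by rewrite /c leqNgt ltn_ord.
rewrite {1}aE mulr_suml; apply: eq_bigr => e _.
by rewrite /c /= leq_addr addKn.
Qed.

Lemma component_id d a : gr d a -> component d a = a.
Proof.
move=> ga; have := component_mul d 1 ga; rewrite mul1r => ->.
rewrite leqnn subnn.
have -> : component 0 1 = 1; last by rewrite mul1r.
apply: (@componentE 1 (fun d => if d is 0 then 1 else 0)); split=> [[|e]|].
- by rewrite -[1]scale1r; apply: gr_scalar.
- exact: (sg_zero sg).
- by exists 1%N; split=> [[]|] //; rewrite big_ord1.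
Qed.

Lemma component1_ex a : exists c : 'I_n -> k, component 1 a = \sum_s c s *: x s.
Proof. exact: (sg_var_span sg) (gr_component 1 a). Qed.

(** The coordinates of the degree 1 part in the basis of variables. They turn
    an [A]-valued function whose values matter only in degree 1 into scalar
    functions. *)
Definition linear_coef (a : A) : 'I_n -> k :=
  epsilon (inhabits (fun _ => 0)) (fun c => component 1 a = \sum_s c s *: x s).

Lemma component1E a : component 1 a = \sum_s linear_coef a s *: x s.
Proof. exact: (epsilon_spec (inhabits (fun _ => 0)) _ (component1_ex a)). Qed.

Lemma var_inj (c c' : 'I_n -> k) :
  \sum_s c s *: x s = \sum_s c' s *: x s -> c =1 c'.
Proof.
move=> eq_cc' s; apply/eqP; rewrite -subr_eq0; apply/eqP; move: s.
apply: (sg_var_free sg); under eq_bigr do rewrite scalerBl.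
by rewrite sumrB eq_cc' subrr.
Qed.

Lemma linear_coef_linear s : linear (fun a => linear_coef a s : k^o).
Proof.
move=> c a b; pose e t := c * linear_coef a t + linear_coef b t.
apply: (@var_inj _ e); rewrite -component1E component_linear !component1E scaler_sumr.
by rewrite -big_split; apply: eq_bigr => t _; rewrite scalerA scalerDl.
Qed.

Lemma gr_max_ideal d a : gr d.+1 a -> max_ideal x a.
Proof.
case/(sg_gen sg) => b [_ ->]; exists b.
by apply: eq_big => [i|i _]; [exact/esym/in_setT | rewrite mulrC].
Qed.

Lemma homog_coef_add p q a b :
  homog_coef gr p q a -> homog_coef gr p q b -> homog_coef gr p q (a + b).
Proof.
by rewrite /homog_coef; case: ifP => _ => [|-> ->]; [apply: gr_add | rewrite addr0].
Qed.

Lemma homog_coef0 p q : homog_coef gr p q 0.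
Proof. by rewrite /homog_coef; case: ifP => // _; apply: (sg_zero sg). Qed.

Lemma homog_coef_opp p q a : homog_coef gr p q a -> homog_coef gr p q (- a).
Proof.
by rewrite /homog_coef; case: ifP => _ => [|->]; [apply: gr_opp | rewrite oppr0].
Qed.

(** The part of [a] which is allowed as coefficient of a basis element of
    degree [q] in an element of degree [p]. *)
Definition hpart (p q : nat) (a : A) : A :=
  if (q <= p)%N then component (p - q) a else 0.

Lemma homog_hpart p q a : homog_coef gr p q (hpart p q a).
Proof. by rewrite /homog_coef /hpart; case: leqP => // _; apply: gr_component. Qed.

Lemma hpart_id p q a : homog_coef gr p q a -> hpart p q a = a.
Proof. by rewrite /homog_coef /hpart; case: leqP => _ => [/component_id|->]. Qed.

(** Multiplication by a homogeneous [b] commutes with truncation; this is what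
    makes solutions of homogeneous linear systems truncatable. *)
Lemma hpart_mul p q q' a b : homog_coef gr q q' b ->
  hpart p q' (a * b) = hpart p q a * b.
Proof.
rewrite /homog_coef /hpart; case: leqP => [le_q'q gb|_ ->]; last first.
  rewrite !mulr0; case: ifP => // _; apply: component_id; exact: (sg_zero sg).
have [le_q'p|lt_pq'] := leqP q' p; last first.
  by rewrite leqNgt (leq_trans lt_pq') // mul0r.
rewrite (component_mul _ _ gb) leq_sub2rE //.
by case: leqP => _; [rewrite subnBA // subnK | rewrite mul0r].
Qed.

End Components.

(** * Words and the duals of the quadratic dual *)

Section Words.
Variables (k : fieldType) (n : nat).

Definition word_tensor (d : nat) (w : seq 'I_n) : tensor k n d :=
  [ffun u : d.-tuple 'I_n => (val u == w)%:R].

(** The pairing of a tensor in dual letters with a function on words; it is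
    the linear map on tensors with prescribed values [z] on words of length [d]. *)
Definition pair_word (M : lmodType k) d (z : seq 'I_n -> M) (g : tensor k n d) : M :=
  \sum_(u : d.-tuple 'I_n) g u *: z u.

Lemma pair_word_linear (M : lmodType k) d (z : seq 'I_n -> M) :
  linear (@pair_word M d z).
Proof.
move=> c g h; rewrite /pair_word scaler_sumr -big_split; apply: eq_bigr => u _.
by rewrite !ffunE scalerA scalerDl.
Qed.

Lemma word_tensor_span d (g : tensor k n d) : g = \sum_u g u *: word_tensor d u.
Proof.
apply/ffunP => v; rewrite sum_ffunE (bigD1 v) //= big1 ?addr0 => [|u neq_uv].
  by rewrite !ffunE eqxx [RHS]mulr1.
by rewrite !ffunE val_eqE eq_sym (negPf neq_uv) [LHS]mulr0.
Qed.

Lemma pair_word_tensor (M : lmodType k) d (z : seq 'I_n -> M) w :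
  size w = d -> pair_word z (word_tensor d w) = z w.
Proof.
move=> /eqP sz_w; rewrite /pair_word (bigD1 (Tuple sz_w)) //= ffunE eqxx scale1r.
rewrite big1 ?addr0 // => u; rewrite -val_eqE /= ffunE => /negPf ->.
by rewrite scale0r.
Qed.

Lemma tensor_lmul_word d s w :
  tensor_lmul k d s (word_tensor d w) = word_tensor d.+1 (s :: w).
Proof.
rewrite lfunE /=; apply/ffunP => u; rewrite !ffunE.
case/tupleP: u => a u; rewrite theadE /= eqseq_cons.
by case: eqP => //= _; rewrite ffunE.
Qed.

Lemma tensor_rmul_word d s w :
  tensor_rmul k d s (word_tensor d w) = word_tensor d.+1 (rcons w s).
Proof.
rewrite lfunE /=; apply/ffunP => u; rewrite !ffunE.
set u' := [tuple _ | i < d].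
have -> : val u = rcons u' (tnth u ord_max).
  apply: (@eq_from_nth _ s) => [|i]; first by rewrite size_rcons !size_tuple.
  rewrite size_tuple ltnS leq_eqVlt nth_rcons size_tuple.
  case/orP=> [/eqP ->|lt_id]; first by rewrite ltnn eqxx (tnth_nth s).
  by rewrite lt_id -[i]/(val (Ordinal lt_id)) -tnth_nth tnth_mktuple (tnth_nth s).
by rewrite eqseq_rcons andbC; case: eqP => //= _; rewrite ?ffunE.
Qed.

Lemma tensor_lmulE d s (g : tensor k n d) :
  tensor_lmul k d s g = \sum_u g u *: word_tensor d.+1 (s :: u).
Proof.
rewrite {1}[g]word_tensor_span linear_sum; apply: eq_bigr => u _.
by rewrite linearZ /= tensor_lmul_word.
Qed.

Lemma tensor_rmulE d s (g : tensor k n d) :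
  tensor_rmul k d s g = \sum_u g u *: word_tensor d.+1 (rcons u s).
Proof.
rewrite {1}[g]word_tensor_span linear_sum; apply: eq_bigr => u _.
by rewrite linearZ /= tensor_rmul_word.
Qed.

Lemma pair_word_lmul (M : lmodType k) d (z : seq 'I_n -> M) s (g : tensor k n d) :
  pair_word z (tensor_lmul k d s g) = pair_word (fun w => z (s :: w)) g.
Proof.
rewrite tensor_lmulE linear_sum_scale; last exact: pair_word_linear.
by apply: eq_bigr => u _; rewrite pair_word_tensor //= size_tuple.
Qed.

Lemma pair_word_rmul (M : lmodType k) d (z : seq 'I_n -> M) s (g : tensor k n d) :
  pair_word z (tensor_rmul k d s g) = pair_word (fun w => z (rcons w s)) g.
Proof.
rewrite tensor_rmulE linear_sum_scale; last exact: pair_word_linear.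
by apply: eq_bigr => u _; rewrite pair_word_tensor //= size_rcons size_tuple.
Qed.

Lemma tensor_lrmulC d s j (g : tensor k n d) :
  tensor_lmul k d.+1 s (tensor_rmul k d j g) =
  tensor_rmul k d.+1 j (tensor_lmul k d s g).
Proof.
rewrite tensor_lmulE -[LHS]/(pair_word (fun w => word_tensor d.+2 (s :: w)) _) pair_word_rmul.
by rewrite tensor_rmulE -[RHS]/(pair_word (fun w => word_tensor d.+2 (rcons w j)) _) pair_word_lmul.
Qed.

(** Maps induced on quotients are defined through chosen representatives; the
    choice is immaterial as soon as the map respects the two subspaces. *)
Lemma quotv_pi_repr (V W : vectType k) (U : {vspace V}) (U' : {vspace W})
    (f : 'Hom(V, W)) v :
  (forall u, u \in U -> f u \in U') ->
  quotv_pi U' (f (quotv_repr U (quotv_pi U v))) = quotv_pi U' (f v).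
Proof.
move=> fU; apply/eqP; rewrite -subr_eq0 -linearB -linearB /= quotv_pi_eq0 fU //.
by rewrite -quotv_pi_eq0 linearB /= quotv_reprK subrr.
Qed.

Lemma perpP (Q : {vspace tensor k n 2}) (p : tensor k n 2) :
  reflect (forall q, q \in Q -> \sum_w p w * q w = 0) (p \in perp Q).
Proof.
have perpE : (p \in perp Q) = all (fun q => pairing_fun q p == 0) (vbasis Q).
  rewrite /perp; elim: (tval (vbasis Q)) => [|q s IHs]; first by rewrite big_nil memvf.
  by rewrite big_cons memv_cap IHs memv_ker lfunE.
rewrite perpE; apply: (iffP allP) => [p0 q Qq|p0 q Bq]; last first.
  apply/eqP; rewrite /pairing_fun -[RHS](p0 q) ?(vbasis_mem Bq) //.
  by apply: eq_bigr => w _; rewrite mulrC.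
rewrite (coord_vbasis Qq).
transitivity (\sum_i coord (vbasis Q) i q * pairing_fun (vbasis Q)`_i p).
  under eq_bigr do rewrite sum_ffunE mulr_sumr.
  rewrite exchange_big; apply: eq_bigr => i _.
  rewrite /pairing_fun mulr_sumr; apply: eq_bigr => w _.
  by rewrite ffunE mulrCA [_ * p w]mulrC.
rewrite big1 // => i _; rewrite (eqP (p0 _ _)) ?mulr0 //.
by rewrite mem_nth // size_tuple.
Qed.

(** [Q] is its own double orthogonal: the coordinates of a projection with
    kernel [Q] are functionals lying in [perp Q], and they detect [Q]. *)
Lemma perp_perp (Q : {vspace tensor k n 2}) (q : tensor k n 2) :
  (forall p, p \in perp Q -> \sum_w p w * q w = 0) -> q \in Q.
Proof.
move=> q0; pose rho t := quotv_repr Q (quotv_pi Q t).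
have rhoE t w : rho t w = \sum_u t u * rho (word_tensor 2 u) w.
  rewrite {1}[t]word_tensor_span /rho !linear_sum /= sum_ffunE.
  by apply: eq_bigr => u _; rewrite !linearZ /= ffunE.
rewrite -quotv_pi_eq0 -[quotv_pi Q q]quotv_reprK -/(rho q).
suff -> : rho q = 0 by rewrite linear0.
apply/ffunP => w; rewrite rhoE ffunE.
rewrite -[RHS](q0 [ffun u : 2.-tuple 'I_n => rho (word_tensor 2 u) w]).
  by apply: eq_bigr => u _; rewrite ffunE mulrC.
apply/perpP => t Qt; transitivity (rho t w).
  by rewrite rhoE; apply: eq_bigr => u _; rewrite ffunE mulrC.
by move: Qt; rewrite -quotv_pi_eq0 /rho => /eqP ->; rewrite linear0 ffunE.
Qed.

Lemma sum_word2 (M : nmodType) (F : seq 'I_n -> M) :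
  \sum_(w : 2.-tuple 'I_n) F w = \sum_a \sum_b F [:: a; b].
Proof.
rewrite pair_bigA /= (reindex (fun p : 'I_n * 'I_n => [tuple p.1; p.2])) //=.
exists (fun w : 2.-tuple 'I_n => (tnth w 0, tnth w 1)) => [[a b] _|w _] //=.
apply/val_inj; case: w => [[|a [|b []]] sw] //=.
Qed.

End Words.

Section KoszulTensors.
Variables (k : fieldType) (n : nat) (Q2 : {vspace tensor k n 2}).

Definition quad_tensor (M : lmodType k) (d : nat) (z : seq 'I_n -> M) : Prop :=
  forall u v p, p \in perp Q2 -> (size u + size v).+2 = d ->
    \sum_(w : 2.-tuple 'I_n) p w *: z (u ++ w ++ v) = 0.

(** For [M = A] these functions, restricted to the words of length [d], are the
    elements of [A (x) (B_d)^*], where [B = A^! / L] and [L] is the left ideal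
    generated by the dual letters outside [Y]; for [M = k] they are the
    functionals on [B_d]. Values on words of other lengths are junk. *)
Definition koszul_tensor (M : lmodType k) (Y : {set 'I_n}) (d : nat)
    (z : seq 'I_n -> M) : Prop :=
  (forall w s, (size w).+1 = d -> s \notin Y -> z (rcons w s) = 0) /\
  quad_tensor d z.

Section Theory.
Variables (M : lmodType k).
Implicit Types (Y : {set 'I_n}) (z : seq 'I_n -> M).

Lemma koszul_tensor_comp (N : lmodType k) (f : M -> N) Y d z :
  linear f -> koszul_tensor Y d z -> koszul_tensor Y d (f \o z).
Proof.
move=> lin_f [zY zQ].
have f0 : f 0 = 0 by have := linear_sum_scale lin_f (fun i : void => 0) (fun=> 0);
  rewrite !big_pred0 // => -[].
split=> [w s sz sY|u v p pQ sz] /=; first by rewrite zY.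
by rewrite -linear_sum_scale // zQ.
Qed.

Lemma koszul_tensor_lin Y d (c : k) z z' :
  koszul_tensor Y d z -> koszul_tensor Y d z' ->
  koszul_tensor Y d (fun w => c *: z w + z' w).
Proof.
move=> [zY zQ] [zY' zQ']; split=> [w s sz sY|u v p pQ sz].
  by rewrite zY // zY' // scaler0 addr0.
under eq_bigr do rewrite scalerDr scalerA mulrC -scalerA.
by rewrite big_split -scaler_sumr /= zQ // zQ' // scaler0 addr0.
Qed.

Lemma koszul_tensor0 Y d : koszul_tensor Y d (fun=> 0 : M).
Proof. by split=> // u v p _ _; rewrite big1 // => w _; rewrite scaler0. Qed.

Lemma koszul_tensor_add Y d z z' :
  koszul_tensor Y d z -> koszul_tensor Y d z' ->
  koszul_tensor Y d (fun w => z w + z' w).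
Proof.
move=> Kz Kz'; have [zY zQ] := koszul_tensor_lin 1 Kz Kz'.
split=> [w s sz sY|u v p pQ sz]; first by rewrite -(zY w s) // scale1r.
by rewrite -[RHS](zQ u v p) //; apply: eq_bigr => w _; rewrite scale1r.
Qed.

Lemma koszul_tensor_sum Y d (I : finType) (z : I -> seq 'I_n -> M) :
  (forall i, koszul_tensor Y d (z i)) -> koszul_tensor Y d (fun w => \sum_i z i w).
Proof.
move=> Kz; split=> [w s sz sY|u v p pQ sz].
  by rewrite big1 // => i _; have [-> //] := Kz i.
under eq_bigr do rewrite scaler_sumr.
by rewrite exchange_big big1 // => i _; have [_ ->] := Kz i.
Qed.

Lemma koszul_tensor_sub Y Y' d z :
  Y \subset Y' -> koszul_tensor Y d z -> koszul_tensor Y' d z.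
Proof. by move=> /subsetP sYY' [zY zQ]; split=> // w s sz /(contra (sYY' s)); apply: zY. Qed.

Lemma koszul_tensor_cons Y d s z :
  koszul_tensor Y d.+1 z -> koszul_tensor Y d (fun w => z (s :: w)).
Proof.
move=> [zY zQ]; split=> [w j sz jY|u v p pQ sz].
  by rewrite -rcons_cons zY //= sz.
by rewrite -[RHS](zQ (s :: u) v p) //= -sz.
Qed.

Lemma quad_tensor_rcons d s z :
  quad_tensor d.+1 z -> quad_tensor d (fun w => z (rcons w s)).
Proof.
move=> zQ u v p pQ sz; rewrite -[RHS](zQ u (rcons v s) p) //; last first.
  by rewrite size_rcons addnS sz.
by apply: eq_bigr => w _; rewrite !rcons_cat.
Qed.

(** The ideal grows by multiplications on either side, which under the pairing
    strip the first or the last letter; the conditions defining [quad_tensor]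
    survive such a stripping. *)
Lemma dual_ideal_kills d z (g : tensor k n d) :
  quad_tensor d z -> g \in dual_ideal Q2 d -> pair_word z g = 0.
Proof.
elim: d z g => [|d IHd] z g zQ /=.
  rewrite memv0 => /eqP ->; rewrite /pair_word big1 // => u _.
  by rewrite ffunE scale0r.
have kill0 : pair_word z (0 : tensor k n d.+1) = 0.
  by rewrite /pair_word big1 // => u _; rewrite ffunE scale0r.
have killD g1 g2 : pair_word z g1 = 0 -> pair_word z g2 = 0 ->
    pair_word z (g1 + g2 : tensor k n d.+1) = 0.
  by move=> g10 g20; rewrite -[g1]scale1r pair_word_linear g10 g20 scaler0 addr0.
case/memv_addP => g1 /memv_addP[g0 g0in [g2 g2in ->]] [g3 g3in ->].
apply: (killD _ _); first apply: (killD _ _).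
- move: z zQ g0 g0in {IHd kill0 killD g1 g2 g2in g3 g3in g}; case: d => [|[|d]] z zQ g0 /=;
    rewrite ?memv0; try by move=> /eqP ->; rewrite /pair_word big1 // => u _;
    rewrite ffunE scale0r.
  move=> g0Q; rewrite -[RHS](zQ [::] [::] g0) //.
  by apply: eq_bigr => w _; rewrite cats0.
- case/memv_sumP: g2in => f fin ->; elim/big_ind: _ => // s _.
  have /memv_imgP[h hin ->] := fin s isT; rewrite pair_word_lmul.
  apply: IHd => // u v p pQ sz; rewrite -[RHS](zQ (s :: u) v p) //=.
  by rewrite -sz.
- case/memv_sumP: g3in => f fin ->; elim/big_ind: _ => // s _.
  have /memv_imgP[h hin ->] := fin s isT; rewrite pair_word_rmul.
  by apply: IHd => //; apply: quad_tensor_rcons.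
Qed.

End Theory.

Lemma dual_ideal_lmul d s (g : tensor k n d) :
  g \in dual_ideal Q2 d -> tensor_lmul k d s g \in dual_ideal Q2 d.+1.
Proof.
move=> gD; apply: (subvP (addvSl _ _)); apply: (subvP (addvSr _ _)).
by apply: (subvP (sumv_sup s _ (subvv _))) => //; apply: memv_img.
Qed.

Lemma dual_ideal_rmul d s (g : tensor k n d) :
  g \in dual_ideal Q2 d -> tensor_rmul k d s g \in dual_ideal Q2 d.+1.
Proof.
move=> gD; apply: (subvP (addvSr _ _)).
by apply: (subvP (sumv_sup s _ (subvv _))) => //; apply: memv_img.
Qed.

Lemma perp_word_dual_ideal d u v (p : tensor k n 2) :
  p \in perp Q2 -> (size u + size v).+2 = d ->
  \sum_(w : 2.-tuple 'I_n) p w *: word_tensor k d (u ++ w ++ v) \in dual_ideal Q2 d.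
Proof.
move=> pQ; elim: u d => [|s u IHu] d /=.
  elim/last_ind: v d => [|v s IHv] d /=.
    move=> <-; under eq_bigr do rewrite cats0.
    by rewrite -word_tensor_span; apply: subvP pQ; rewrite /= -addvA addvSl.
  rewrite size_rcons => <-; pose g := \sum_w p w *: word_tensor k (size v).+2 (tval w ++ v).
  have -> : \sum_w p w *: word_tensor k (size v).+3 (tval w ++ rcons v s) = tensor_rmul k _ s g.
    rewrite linear_sum; apply: eq_bigr => w _.
    by rewrite linearZ /= tensor_rmul_word rcons_cat.
  by apply/dual_ideal_rmul/IHv.
move=> <-; rewrite addSn.
pose g := \sum_w p w *: word_tensor k (size u + size v).+2 (u ++ tval w ++ v).
have -> : \sum_w p w *: word_tensor k (size u + size v).+3 (s :: u ++ tval w ++ v)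
    = tensor_lmul k _ s g.
  by rewrite linear_sum; apply: eq_bigr => w _; rewrite linearZ /= tensor_lmul_word.
by apply/dual_ideal_lmul/IHu.
Qed.

Section Bmodule.
Variable E : {set 'I_n}.

Definition Bclass (d : nat) : 'Hom(tensor k n d, Bmod Q2 E d) :=
  (quotv_pi (Lideal Q2 E d) \o quotv_pi (dual_ideal Q2 d))%VF.

Definition Bword (d : nat) (w : seq 'I_n) : Bmod Q2 E d := Bclass d (word_tensor k d w).

Lemma qdual_lmulE d s g :
  qdual_lmul Q2 d s (quotv_pi (dual_ideal Q2 d) g) =
  quotv_pi (dual_ideal Q2 d.+1) (tensor_lmul k d s g).
Proof. by rewrite !comp_lfunE quotv_pi_repr // => u; apply: dual_ideal_lmul. Qed.

Lemma qdual_rmulE d s g :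
  qdual_rmul Q2 d s (quotv_pi (dual_ideal Q2 d) g) =
  quotv_pi (dual_ideal Q2 d.+1) (tensor_rmul k d s g).
Proof. by rewrite !comp_lfunE quotv_pi_repr // => u; apply: dual_ideal_rmul. Qed.

Lemma qdual_lrmulC d s j b :
  qdual_lmul Q2 d.+1 s (qdual_rmul Q2 d j b) =
  qdual_rmul Q2 d.+1 j (qdual_lmul Q2 d s b).
Proof.
by rewrite -[b]quotv_reprK qdual_rmulE !qdual_lmulE tensor_lrmulC -qdual_rmulE.
Qed.

Lemma Lideal_rmul d j b : j \notin E -> qdual_rmul Q2 d j b \in Lideal Q2 E d.+1.
Proof.
by move=> jE; apply: (subvP (sumv_sup j jE (subvv _))); apply/memv_img/memvf.
Qed.

Lemma Lideal_lmul d s b :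
  b \in Lideal Q2 E d -> qdual_lmul Q2 d s b \in Lideal Q2 E d.+1.
Proof.
case: d b => [|d] b; first by rewrite memv0 => /eqP ->; rewrite linear0 mem0v.
case/memv_sumP => f fin ->; rewrite linear_sum memv_suml // => j jE.
have /memv_imgP[c _ ->] := fin j jE.
by rewrite /= qdual_lrmulC Lideal_rmul.
Qed.

Lemma Bmod_lmul_class d s g :
  Bmod_lmul Q2 E d s (Bclass d g) = Bclass d.+1 (tensor_lmul k d s g).
Proof.
transitivity (quotv_pi (Lideal Q2 E d.+1) (qdual_lmul Q2 d s (quotv_repr _
    (quotv_pi (Lideal Q2 E d) (quotv_pi (dual_ideal Q2 d) g))))).
  by rewrite !comp_lfunE.
rewrite quotv_pi_repr => [|u]; last exact: Lideal_lmul.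
by rewrite qdual_lmulE comp_lfunE.
Qed.

Lemma Bmod_lmul_word d s w : Bmod_lmul Q2 E d s (Bword d w) = Bword d.+1 (s :: w).
Proof. by rewrite Bmod_lmul_class tensor_lmul_word. Qed.

Lemma Bmod_one_word : Bmod_one Q2 E = Bword 0 [::].
Proof.
rewrite /Bmod_one /Bword comp_lfunE; congr (quotv_pi _ (quotv_pi _ _)).
by apply/ffunP => u; rewrite !ffunE tuple0.
Qed.

Lemma koszul_tensor_Bword d : koszul_tensor E d (Bword d).
Proof.
split=> [w s sz sE|u v p pQ sz].
  case: d sz => // d [sz]; rewrite /Bword -tensor_rmul_word comp_lfunE -qdual_rmulE.
  by apply/eqP; rewrite quotv_pi_eq0 Lideal_rmul.
rewrite /Bword; under eq_bigr do rewrite -linearZ.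
rewrite -linear_sum /= comp_lfunE.
have /eqP -> : quotv_pi (dual_ideal Q2 d)
    (\sum_(w : 2.-tuple 'I_n) p w *: word_tensor k d (u ++ w ++ v)) == 0.
  by rewrite quotv_pi_eq0; apply: perp_word_dual_ideal.
by rewrite linear0.
Qed.

Lemma Bclass_kills (M : lmodType k) d (z : seq 'I_n -> M) g :
  koszul_tensor E d z -> Bclass d g = 0 -> pair_word z g = 0.
Proof.
move=> [zE zQ]; rewrite comp_lfunE => /eqP; rewrite quotv_pi_eq0.
case: d g zE zQ => [|d] g zE zQ.
  rewrite memv0 quotv_pi_eq0; exact: dual_ideal_kills.
case/memv_sumP => f fin fE.
(* Modulo the relations, [g] is a combination [g'] of words ending outside [E]. *)
have /all_sig[c cE] : forall j, {c | j \notin E -> f j = qdual_rmul Q2 d j c}.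
  move=> j; exists ((qdual_rmul Q2 d j)^-1%VF (f j)) => jE.
  by apply/esym/limg_lfunVK/(fin j jE).
pose g' := \sum_(j < n | j \notin E) tensor_rmul k d j (quotv_repr _ (c j)).
have kill' : pair_word z g' = 0.
  rewrite /g' big_mkcond /=.
  have -> : \sum_j (if j \notin E then tensor_rmul k d j (quotv_repr _ (c j)) else 0)
      = \sum_j (j \notin E)%:R *: tensor_rmul k d j (quotv_repr _ (c j)).
    by apply: eq_bigr => j _; case: ifP => _; rewrite ?scale1r ?scale0r.
  rewrite linear_sum_scale; last exact: pair_word_linear.
  rewrite big1 // => j _; case: (boolP (j \in E)) => jE; first by rewrite scale0r.
  rewrite scale1r pair_word_rmul /pair_word big1 // => u _.
  by rewrite zE ?scaler0 // size_tuple.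
rewrite -[g](subrK g') -[g - g']scale1r pair_word_linear kill' addr0 scale1r.
apply: dual_ideal_kills => //; rewrite -quotv_pi_eq0 linearB /= fE subr_eq0.
apply/eqP; rewrite linear_sum; apply: eq_bigr => j jE.
by rewrite cE // -{1}[c j]quotv_reprK qdual_rmulE.
Qed.

(** [Bword] is the universal function of this kind: the relations satisfied by
    the words in [B_d] are exactly the conditions in [koszul_tensor]. *)
Lemma koszul_tensor_lift (M : lmodType k) d (z : seq 'I_n -> M) :
  koszul_tensor E d z ->
  exists h : Bmod Q2 E d -> M, linear h /\ forall w, size w = d -> z w = h (Bword d w).
Proof.
move=> Kz; pose rep b := quotv_repr (dual_ideal Q2 d) (quotv_repr (Lideal Q2 E d) b).
exists (fun b => pair_word z (rep b)); split=> [c a b|w sz].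
  by rewrite /rep !linearP pair_word_linear.
rewrite -(pair_word_tensor _ sz); apply/eqP; rewrite eq_sym -subr_eq0 addrC -scaleN1r.
rewrite -pair_word_linear (Bclass_kills Kz) // linearP /= scaleN1r.
apply/eqP; rewrite addrC subr_eq0; apply/eqP.
by rewrite [LHS]comp_lfunE /rep !quotv_reprK.
Qed.

(** Since [B_d] has finite dimension, an element of [M (x) (B_d)^*] is a finite
    sum of pure tensors; this reduces questions about [A]-valued functions to
    scalar ones, to which the relations of [A] apply directly. *)
Lemma koszul_tensor_split (M : lmodType k) d (z : seq 'I_n -> M) :
  koszul_tensor E d z ->
  exists (m : nat) (t : 'I_m -> seq 'I_n -> k^o) (a : 'I_m -> M),
    (forall i, koszul_tensor E d (t i)) /\
    forall w, size w = d -> z w = \sum_i t i w *: a i.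
Proof.
case/koszul_tensor_lift => h [lin_h zh].
exists (\dim {: Bmod Q2 E d}), (fun i w => coord (vbasis fullv) i (Bword d w)).
exists (fun i => h (vbasis fullv)`_i); split=> [i|w sz].
  have lin_i : linear (coord (vbasis fullv) i : Bmod Q2 E d -> k^o) by apply: linearP.
  exact: koszul_tensor_comp lin_i (koszul_tensor_Bword d).
rewrite zh // {1}(coord_vbasis (memvf (Bword d w))); exact: linear_sum_scale.
Qed.

End Bmodule.

End KoszulTensors.

(** * Exactness of the Koszul strands *)

Section Ideals.
Variables (k : fieldType) (A : comAlgType k).

Lemma ideal_gen_lin (I : finType) (P : pred I) (g : I -> A) c a b :
  ideal_gen P g a -> ideal_gen P g b -> ideal_gen P g (c * a + b).
Proof.
move=> [e ->] [f ->]; exists (fun i => c * e i + f i).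
by rewrite mulr_sumr -big_split; apply: eq_bigr => i _; rewrite mulrDl mulrA.
Qed.

Lemma ideal_gen0 (I : finType) (P : pred I) (g : I -> A) : ideal_gen P g 0.
Proof. by exists (fun=> 0); rewrite big1 // => i _; rewrite mul0r. Qed.

Lemma ideal_genD (I : finType) (P : pred I) (g : I -> A) a b :
  ideal_gen P g a -> ideal_gen P g b -> ideal_gen P g (a + b).
Proof. by move=> Ia Ib; rewrite -[a]mul1r; apply: ideal_gen_lin. Qed.

Lemma ideal_genM (I : finType) (P : pred I) (g : I -> A) c a :
  ideal_gen P g a -> ideal_gen P g (c * a).
Proof.
by move=> Ia; rewrite -[c * a]addr0; apply: ideal_gen_lin => //; apply: ideal_gen0.
Qed.

Lemma ideal_genN (I : finType) (P : pred I) (g : I -> A) a :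
  ideal_gen P g a -> ideal_gen P g (- a).
Proof. by rewrite -mulN1r; apply: ideal_genM. Qed.

Lemma ideal_gen_gen (I : finType) (P : pred I) (g : I -> A) i :
  P i -> ideal_gen P g (g i).
Proof.
move=> Pi; exists (fun j => (j == i)%:R); rewrite (bigD1 i) //= eqxx mul1r big1 ?addr0 //.
by move=> j /andP[_ /negPf ->]; rewrite mul0r.
Qed.

Lemma ideal_gen_sum (I J : finType) (P : pred I) (g : I -> A) (Q : pred J) F :
  (forall j, Q j -> ideal_gen P g (F j)) -> ideal_gen P g (\sum_(j | Q j) F j).
Proof.
by move=> IF; elim/big_ind: _ => //; [apply: ideal_gen0 | move=> a b; apply: ideal_genD].
Qed.

End Ideals.

Section Exactness.
Variables (k : fieldType) (A : comAlgType k) (gr : nat -> A -> Prop).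
Variables (n : nat) (x : 'I_n -> A) (Q2 : {vspace tensor k n 2}).
Hypothesis sg : standard_graded gr x.
Hypothesis rel2 : quadratic_relations x Q2.

Implicit Types (Y Z : {set 'I_n}) (z : seq 'I_n -> A).

(** Comparing degree 1 parts: only the degree 0 parts of the coefficients of
    the generators of [(Z)] contribute. *)
Lemma var_ideal_coef Z (c : 'I_n -> k) :
  var_ideal x Z (\sum_s c s *: x s) -> forall s, s \notin Z -> c s = 0.
Proof.
case=> b cb s sZ.
have eE i : exists e : k, component gr 0 (b i) = e%:A.
  by apply/(sg_one sg); apply: (gr_component sg).
have /(fin_all_exists (P := fun i e => component gr 0 (b i) = e%:A))[e bE] := eE.
have gc : gr 1 (\sum_s c s *: x s).
  by apply: (gr_sum sg) => i _; apply: (gr_scale sg); apply: (sg_var sg).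
suff /(var_inj sg) -> : \sum_s c s *: x s = \sum_s (s \in Z)%:R * e s *: x s.
  by rewrite (negPf sZ) mul0r.
rewrite -(component_id sg gc) cb (component_sum sg) big_mkcond.
apply: eq_bigr => i _; rewrite -[mem Z i]/(i \in Z); case: ifP => _.
  by rewrite (component_mul sg _ _ (sg_var sg i)) /= subnn bE mul1r mulr_algl.
by rewrite mul0r scale0r.
Qed.

(** Two consecutive letters of [t] are orthogonal to [perp Q2], so they form a
    relation of [A] because [Q2] is its own double orthogonal. *)
Lemma quad_tensor_relation d (t : seq 'I_n -> k^o) u v :
  quad_tensor Q2 d t -> (size u + size v).+2 = d ->
  \sum_a \sum_b t (u ++ [:: a, b & v]) *: (x a * x b) = 0.
Proof.
move=> tQ sz; pose q : tensor k n 2 := [ffun w : 2.-tuple 'I_n => t (u ++ w ++ v)].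
have /rel2 : q \in Q2.
  apply: perp_perp => p pQ; rewrite -[RHS](tQ u v p) //.
  by apply: eq_bigr => w _; rewrite ffunE.
move=> q0; rewrite -[RHS]q0.
pose F (w : seq 'I_n) := if w is [:: a; b] then t (u ++ w ++ v) *: (x a * x b) else 0.
rewrite -(sum_word2 F); apply: eq_bigr => w _; rewrite ffunE.
by case: w => [[|a [|b []]] sw].
Qed.

(** The differential of [A (x) (B)^*] in terms of functions on words. *)
Definition koszul_diff z (w : seq 'I_n) : A := \sum_s x s * z (s :: w).

Lemma mulr_linear (a : A) : linear ( *%R a : A -> A).
Proof. by move=> c b b'; rewrite mulrDr -scalerAr. Qed.

Lemma koszul_tensor_diff Y d z :
  koszul_tensor Q2 Y d.+1 z -> koszul_tensor Q2 Y d (koszul_diff z).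
Proof.
move=> Kz; apply: koszul_tensor_sum => s.
exact: koszul_tensor_comp (mulr_linear (x s)) (koszul_tensor_cons s Kz).
Qed.

Lemma koszul_diffK Y d z w :
  koszul_tensor Q2 Y d.+2 z -> size w = d -> koszul_diff (koszul_diff z) w = 0.
Proof.
case/koszul_tensor_split => m [t [c [Kt zE]]] sz.
transitivity (\sum_i (\sum_a \sum_b t i ([::] ++ [:: a, b & w]) *: (x a * x b)) * c i).
  rewrite /koszul_diff; under eq_bigr do rewrite mulr_sumr.
  rewrite exchange_big /=; under [RHS]eq_bigr do rewrite mulr_suml.
  rewrite [RHS]exchange_big; apply: eq_bigr => a _.
  under [RHS]eq_bigr do rewrite mulr_suml.
  rewrite [RHS]exchange_big; apply: eq_bigr => b _.
  rewrite zE /= ?sz // !mulr_sumr; apply: eq_bigr => i _.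
  by rewrite -!scalerAr -scalerAl mulrA [x a * x b]mulrC.
rewrite big1 // => i _; have [_ tQ] := Kt i.
by rewrite (quad_tensor_relation tQ) ?mul0r //= sz.
Qed.

(** It is enough to treat a scalar [z]. Its last two letters form a relation of
    [A], which modulo [(Y)] says that some linear form times [x i] is 0; so this
    linear form lies in the colon ideal [(Z)], and its coefficients, which are
    values of [z] at words ending in [i], are supported on [Z]. *)
Lemma koszul_tensor_strip Y i Z d (M : lmodType k) (z : seq 'I_n -> M) :
  i \notin Y -> same_ideal (colon (var_ideal x Y) (x i)) (var_ideal x Z) ->
  koszul_tensor Q2 (i |: Y) d.+1 z -> koszul_tensor Q2 Z d (fun w => z (rcons w i)).
Proof.
move=> iY colZ Kz; split; last by apply: quad_tensor_rcons; case: Kz.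
move=> w s sz sZ; have [m [t [c [Kt zE]]]] := koszul_tensor_split Kz.
rewrite zE ?size_rcons ?sz // big1 // => j _.
suff -> : t j (rcons (rcons w s) i) = 0 by rewrite scale0r.
have [tY tQ] := Kt j; pose e a := t j (w ++ [:: a; i]).
have -> : rcons (rcons w s) i = w ++ [:: s; i] by rewrite -!cats1 -catA.
apply: (@var_ideal_coef Z e) => //; apply/colZ; rewrite /colon.
have := quad_tensor_relation (v := [::]) tQ; move/(_ w); rewrite addn0 sz => /(_ erefl).
rewrite exchange_big (bigD1 i) //= => /eqP; rewrite addr_eq0 => /eqP.
have -> : \sum_a t j (w ++ [:: a; i]) *: (x a * x i) = (\sum_a e a *: x a) * x i.
  by rewrite mulr_suml; apply: eq_bigr => a _; rewrite scalerAl.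
move=> ->; apply/ideal_genN/ideal_gen_sum => b neq_bi; apply: ideal_gen_sum => a _.
have [bY|bY] := boolP (b \in Y).
  by rewrite scalerAl; apply/ideal_genM/ideal_gen_gen.
have -> : w ++ [:: a; b] = rcons (rcons w a) b by rewrite -!cats1 -catA.
rewrite tY ?scale0r; [exact: ideal_gen0 | by rewrite size_rcons sz |].
by rewrite !inE negb_or neq_bi.
Qed.

(** In degree 0 the next term of the complex is [A / (Y)]. *)
Definition koszul_cycle Y d z : Prop :=
  if d is d'.+1 then forall w, size w = d' -> koszul_diff z w = 0
  else var_ideal x Y (z [::]).

Definition koszul_exact d Y : Prop :=
  forall z, koszul_tensor Q2 Y d z -> koszul_cycle Y d z ->
  exists v, koszul_tensor Q2 Y d.+1 v /\ forall w, size w = d -> z w = koszul_diff v w.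

(** Surjectivity on scalar functions of the stripping of the last letter [i],
    from degree [d.+1] for [i |: Y] to degree [d] for [Z]. *)
Definition koszul_liftable d : Prop :=
  forall Y i Z, i \notin Y ->
  same_ideal (colon (var_ideal x Y) (x i)) (var_ideal x Z) ->
  forall t : seq 'I_n -> k^o, koszul_tensor Q2 Z d t ->
  exists W : seq 'I_n -> k^o, koszul_tensor Q2 (i |: Y) d.+1 W /\
    forall w, size w = d -> W (rcons w i) = t w.

Lemma koszul_tensor_diff_cycle Y d z :
  koszul_tensor Q2 Y d.+1 z -> koszul_cycle Y d (koszul_diff z).
Proof.
case: d => [|d] Kz /=; last by move=> w sz; apply: koszul_diffK Kz sz.
apply: ideal_gen_sum => s _; have [sY|sY] := boolP (s \in Y).
  by rewrite mulrC; apply/ideal_genM/ideal_gen_gen.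
by case: Kz => zY _; rewrite -[[:: s]]/(rcons [::] s) zY // mulr0; apply: ideal_gen0.
Qed.

Lemma koszul_exact0 Y : koszul_exact 0 Y.
Proof.
move=> z Kz [c zE]; pose v w := if w is [:: s] then (s \in Y)%:R * c s else 0.
exists v; split=> [|w /size0nil ->].
  split=> [[|a w] s //= _ sY|u v' p _]; first by rewrite (negPf sY) mul0r.
  by [].
rewrite zE /koszul_diff big_mkcond; apply: eq_bigr => s _; rewrite /v.
by rewrite -[mem Y s]/(s \in Y); case: ifP => _; rewrite ?mul1r ?mul0r ?mulr0 1?mulrC.
Qed.

Lemma koszul_liftable0 : koszul_liftable 0.
Proof.
move=> Y i Z iY _ t _; exists (fun w => if w == [:: i] then t [::] else 0).
split=> [|w /size0nil -> /=]; last by rewrite eqxx.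
split=> [w s [/size0nil ->] |u v p _ //].
by rewrite !inE negb_or => /andP[/negPf neq_si _]; rewrite /= eqseq_cons neq_si.
Qed.

(** A preimage of [t] is assembled from preimages [U s] of its parts starting
    with the letter [s]. The first two letters of the result need not form a
    relation; the defect is the boundary of [u = \sum_s U s *: x s], which is a
    cycle for the smaller set [Y], hence also the boundary of some [v] there,
    and [u - v] has no defect. *)
Lemma koszul_liftableS d :
  koszul_liftable d -> (forall Y, koszul_exact d Y) -> koszul_liftable d.+1.
Proof.
move=> lift_d exact_d Y i Z iY colZ t Kt.
have /(fin_all_exists (P := fun s (W : seq 'I_n -> k^o) =>
    koszul_tensor Q2 (i |: Y) d.+1 W /\
    forall w, size w = d -> W (rcons w i) = t (s :: w)))[U UP] :
  forall s, exists W : seq 'I_n -> k^o, koszul_tensor Q2 (i |: Y) d.+1 W /\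
    forall w, size w = d -> W (rcons w i) = t (s :: w).
  move=> s; apply: (lift_d _ _ _ iY colZ (fun w => t (s :: w))).
  exact: koszul_tensor_cons.
pose u w : A := \sum_s U s w *: x s.
have Ku : koszul_tensor Q2 (i |: Y) d.+1 u.
  apply: koszul_tensor_sum => s; have [KU _] := UP s.
  apply: (@koszul_tensor_comp _ _ _ k^o A (fun c : k^o => c *: x s)) KU.
  by move=> c a b; rewrite scalerDl scalerA.
have u_last w : size w = d -> u (rcons w i) = \sum_s t (s :: w) *: x s.
  by move=> sz; apply: eq_bigr => s _; have [_ ->] := UP s.
(* On words ending in [i], this boundary is the double boundary of [t]. *)
have Ky : koszul_tensor Q2 Y d (koszul_diff u).
  have [yY yQ] := koszul_tensor_diff Ku; split=> // w s sz sY.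
  have [->|neq_si] := eqVneq s i; last by apply: yY => //; rewrite !inE negb_or neq_si.
  have [_ tQ] := Kt; rewrite -[RHS](quad_tensor_relation (u := [::]) (v := w) tQ) ?sz //.
  rewrite [RHS]exchange_big; apply: eq_bigr => a _; rewrite -rcons_cons u_last //=.
  by rewrite mulr_sumr; apply: eq_bigr => b _; rewrite -scalerAr mulrC.
have cy : koszul_cycle Y d (koszul_diff u).
  case: d {lift_d exact_d Ky} Kt UP Ku u_last => [|d] Kt UP Ku u_last; last first.
    exact: koszul_tensor_diff_cycle Ku.
  rewrite /= /koszul_diff (bigD1 i) //= -[[:: i]]/(rcons [::] i) u_last //.
  apply: ideal_genD.
    rewrite mulrC; apply/colZ/ideal_gen_sum => s _.
    have [sZ|sZ] := boolP (s \in Z).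
      by rewrite -mulr_algl; apply/ideal_genM/ideal_gen_gen.
    case: Kt => tZ _; rewrite -[[:: s]]/(rcons [::] s) tZ // scale0r.
    exact: ideal_gen0.
  apply: ideal_gen_sum => s neq_si; have [sY|sY] := boolP (s \in Y).
    by rewrite mulrC; apply/ideal_genM/ideal_gen_gen.
  case: Ku => uY _; rewrite -[[:: s]]/(rcons [::] s) uY // ?mulr0; first exact: ideal_gen0.
  by rewrite !inE negb_or neq_si.
have [v [Kv yv]] := exact_d Y _ Ky cy.
(* As [u] has degree 1, only the degree 1 part of [v] counts: its coordinates
   [c a] play the same role as the [U a]. *)
pose c a w : k^o := linear_coef gr x (v w) a.
have Kc a : koszul_tensor Q2 Y d.+1 (c a).
  exact: koszul_tensor_comp (linear_coef_linear sg a) Kv.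
pose W (w : seq 'I_n) : k^o := if w is a :: w' then U a w' - c a w' else 0.
have KW a : koszul_tensor Q2 (i |: Y) d.+1 (fun w => W (a :: w)).
  have Kca := koszul_tensor_sub (subsetUr [set i] Y) (Kc a).
  have [KU _] := UP a; have [WY WQ] := koszul_tensor_lin (-1) Kca KU.
  split=> [w s sz sY|u' v' p pQ sz].
    by rewrite /W -[RHS](WY w s) // scaleN1r addrC.
  rewrite -[RHS](WQ u' v' p) //; apply: eq_bigr => w _.
  by rewrite /W scaleN1r addrC.
exists W; split; last first.
  move=> [|a w] //= [sz]; have [_ ->] := UP a => //; have [cY _] := Kc a.
  by rewrite (cY w i) ?subr0 // sz.
split=> [[|a w] s //= [sz] sY|[|a u'] v' p pQ].
- by have [/(_ w s) WY _] := KW a; rewrite -[LHS]/(W (a :: rcons w s)) WY // sz.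
- rewrite add0n => -[sz].
  pose q : tensor k n 2 := [ffun w : 2.-tuple 'I_n => W (w ++ v')].
  suff qQ2 : q \in Q2.
    by rewrite -[RHS](perpP _ _ pQ q qQ2); apply: eq_bigr => w _; rewrite ffunE.
  apply/rel2.
  pose F (w : seq 'I_n) := if w is [:: a; b] then W (w ++ v') *: (x a * x b) else 0.
  transitivity (\sum_(w : 2.-tuple 'I_n) F w).
    by apply: eq_bigr => w _; rewrite ffunE; case: w => [[|a [|b []]] sw].
  rewrite sum_word2 /F /=.
  (* The first two letters of [W] multiply to the boundary of [u] minus the
     degree 2 part of the boundary of [v], which are equal. *)
  have y2 : component gr 2 (koszul_diff u v') = koszul_diff u v'.
    apply: (component_id sg); apply: (gr_sum sg) => b _; rewrite -[2%N]addn1 addn1 -[2%N]/(1 + 1)%N.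
    apply: (sg_mul sg); first exact: (sg_var sg).
    by apply: (gr_sum sg) => a _; apply: (gr_scale sg); apply: (sg_var sg).
  have uv : koszul_diff u v' = \sum_b \sum_a c a (b :: v') *: (x a * x b).
    rewrite -y2 (yv _ sz) (component_sum sg); apply: eq_bigr => b _.
    rewrite mulrC (component_mul sg _ _ (sg_var sg b)) subn1 (component1E sg) mulr_suml.
    by apply: eq_bigr => a _; rewrite -scalerAl.
  under eq_bigr do under eq_bigr do rewrite scalerBl.
  under eq_bigr do rewrite sumrB.
  rewrite sumrB exchange_big [X in _ - X]exchange_big -uv /=.
  apply/eqP; rewrite subr_eq0; apply/eqP; apply: eq_bigr => b _.
  by rewrite mulr_sumr; apply: eq_bigr => a _; rewrite -scalerAr mulrC.
- move=> /succn_inj sz; have [_ WQ] := KW a.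
  by rewrite -[RHS](WQ u' v' p pQ sz).
Qed.

Hypothesis colon_var : forall Y i, i \notin Y ->
  exists Z, same_ideal (colon (var_ideal x Y) (x i)) (var_ideal x Z).

(** The diagram chase: a cycle [z] stripped of its last letter [i] is a boundary
    by exactness for [Z] one degree lower; lifting the bounding element changes
    [z] by a boundary into a cycle for [Y :\ i], to which induction applies. *)
Lemma koszul_exactS d :
  (forall Y, koszul_exact d Y) -> koszul_liftable d.+1 ->
  forall Y, koszul_exact d.+1 Y.
Proof.
move=> exact_d lift_d Y; have [m] := ubnP #|Y|; elim: m Y => // m IHm Y.
rewrite ltnS => le_Ym z Kz cz.
have [Y0|[i iY]] := set_0Vmem Y.
  exists (fun=> 0); split=> [|w]; first exact: koszul_tensor0.
  case/lastP: w => // w s; rewrite size_rcons => -[sz].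
  case: Kz => zY _; rewrite zY ?sz ?Y0 ?inE //.
  by rewrite /koszul_diff big1 // => a _; rewrite mulr0.
pose Y' := Y :\ i; have iY' : i \notin Y' by rewrite !inE eqxx.
have YE : i |: Y' = Y by apply: setD1K.
have [Z colZ] := colon_var iY'.
have Kzi : koszul_tensor Q2 Z d (fun w => z (rcons w i)).
  by apply: koszul_tensor_strip iY' colZ _; rewrite YE.
have czi : koszul_cycle Z d (fun w => z (rcons w i)).
  case: d {exact_d lift_d Kzi IHm} Kz cz => [|d] Kz cz /=; last first.
    by move=> w sz; rewrite -[RHS](cz (rcons w i)) ?size_rcons ?sz.
  apply/colZ; rewrite /colon; have := cz [::] erefl.
  rewrite /koszul_diff (bigD1 i) //= mulrC => /eqP; rewrite addr_eq0 => /eqP ->.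
  apply/ideal_genN/ideal_gen_sum => s neq_si; have [sY|sY] := boolP (s \in Y).
    by rewrite mulrC; apply/ideal_genM/ideal_gen_gen; rewrite /= !inE neq_si.
  by case: Kz => zY _; rewrite -[[:: s]]/(rcons [::] s) zY // mulr0; apply: ideal_gen0.
have [v [Kv ziv]] := exact_d Z _ Kzi czi.
(* Scalar preimages suffice, since [v] is a combination of scalar functions. *)
have [V [KV Vi]] : exists V, koszul_tensor Q2 Y d.+2 V /\
    forall w, size w = d.+1 -> V (rcons w i) = v w.
  have [l [t [c [Kt vE]]]] := koszul_tensor_split Kv.
  have /(fin_all_exists (P := fun j (W : seq 'I_n -> k^o) =>
      koszul_tensor Q2 Y d.+2 W /\
      forall w, size w = d.+1 -> W (rcons w i) = t j w))[W WP] :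
    forall j, exists W : seq 'I_n -> k^o, koszul_tensor Q2 Y d.+2 W /\
      forall w, size w = d.+1 -> W (rcons w i) = t j w.
    by move=> j; rewrite -YE; apply: (lift_d _ _ _ iY' colZ).
  exists (fun w => \sum_j W j w *: c j); split=> [|w sz].
    apply: koszul_tensor_sum => j; have [KW _] := WP j.
    apply: (@koszul_tensor_comp _ _ _ k^o A (fun e : k^o => e *: c j)) KW.
    by move=> e a b; rewrite scalerDl scalerA.
  by rewrite vE //; apply: eq_bigr => j _; have [_ ->] := WP j.
pose z' w := -1 *: koszul_diff V w + z w.
have Kz' : koszul_tensor Q2 Y' d.+1 z'.
  have [zY zQ] := koszul_tensor_lin (-1) (koszul_tensor_diff KV) Kz.
  split=> // w s [sz] sY'; have [->|neq_si] := eqVneq s i; last first.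
    by apply: zY; rewrite ?sz //; apply: contra sY'; rewrite !inE neq_si.
  rewrite /z' ziv // scaleN1r; apply/eqP; rewrite addrC subr_eq0; apply/eqP.
  by apply: eq_bigr => a _; rewrite -rcons_cons Vi //= sz.
have cz' : koszul_cycle Y' d.+1 z'.
  move=> w sz; transitivity (-1 *: koszul_diff (koszul_diff V) w + koszul_diff z w).
    rewrite /koszul_diff scaler_sumr -big_split; apply: eq_bigr => a _.
    by rewrite mulrDr -scalerAr.
  by rewrite (koszul_diffK KV sz) cz // scaler0 addr0.
have lt_Y' : (#|Y'| < m)%N by rewrite (leq_trans _ le_Ym) // [in X in (_ < X)%N](cardsD1 i) iY.
have [V' [KV' z'E]] := IHm Y' lt_Y' z' Kz' cz'.
exists (fun w => V w + V' w); split=> [|w sz].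
  by apply: koszul_tensor_add => //; apply: koszul_tensor_sub KV'; apply: subD1set.
transitivity (koszul_diff V w + koszul_diff V' w).
  by rewrite -z'E // /z' scaleN1r addNKr.
by rewrite /koszul_diff -big_split; apply: eq_bigr => a _; rewrite mulrDr.
Qed.

Theorem koszul_strand_exact d Y : koszul_exact d Y.
Proof.
suff [exact_d _] : (forall Y, koszul_exact d Y) /\ koszul_liftable d by apply: exact_d.
elim: d => [|d [exact_d lift_d]] {Y}.
  by split; [apply: koszul_exact0 | apply: koszul_liftable0].
have lift_dS := koszul_liftableS lift_d exact_d.
by split=> //; apply: koszul_exactS.
Qed.

End Exactness.

(** * The complexes of the mapping cone construction *)

Section DualBasis.
Variables (k : fieldType) (W : vectType k) (M : lmodType k).

Local Notation phi := (vbasis {: 'Hom(W, k^o)}).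
Local Notation beta := (vbasis {: W}).

Definition dual_coord (i : 'I_(\dim {: 'Hom(W, k^o)})) (m : 'I_(\dim {: W})) : k :=
  coord phi i (linfun (coord beta m : W -> k^o)).

(** Together with [dual_coordK] this formula says that [M] tensor the dual of [W]
    is the space of linear maps from [W] to [M]. *)
Lemma dual_coord_eval (h : W -> M) b : linear h ->
  \sum_(i < \dim {: 'Hom(W, k^o)})
    phi`_i b *: (\sum_(m < \dim {: W}) dual_coord i m *: h beta`_m) = h b.
Proof.
move=> lin_h; under eq_bigr do rewrite scaler_sumr.
rewrite exchange_big /= [in RHS](coord_vbasis (memvf b)) linear_sum_scale //.
apply: eq_bigr => m _; under eq_bigr do rewrite scalerA mulrC.
rewrite -scaler_suml; congr (_ *: _).
transitivity ((\sum_i dual_coord i m *: phi`_i) b).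
  by rewrite sum_lfunE; apply: eq_bigr => i _; rewrite scale_lfunE.
by rewrite -coord_vbasis ?memvf // lfunE.
Qed.

Lemma dual_coordK (v : 'I_(\dim {: 'Hom(W, k^o)}) -> M) i :
  \sum_(m < \dim {: W}) dual_coord i m *:
    (\sum_(j < \dim {: 'Hom(W, k^o)}) phi`_j beta`_m *: v j) = v i.
Proof.
under eq_bigr do rewrite scaler_sumr.
rewrite exchange_big /= (bigD1 i) //=.
have E (j : 'I_(\dim {: 'Hom(W, k^o)})) :
    \sum_(m < \dim {: W}) dual_coord i m *: (phi`_j beta`_m *: v j) = (j == i)%:R *: v j.
  under eq_bigr do rewrite scalerA mulrC.
  rewrite -scaler_suml -(coord_free j i (basis_free (vbasisP _))); congr (_ *: _).
  transitivity (coord phi i (\sum_(m < \dim {: W})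
      phi`_j beta`_m *: linfun (coord beta m : W -> k^o))).
    by rewrite linear_sum; apply: eq_bigr => m _; rewrite linearZ.
  congr (coord _ _ _); apply/lfunP => b; rewrite sum_lfunE.
  rewrite [in RHS](coord_vbasis (memvf b)) linear_sum; apply: eq_bigr => m _.
  by rewrite scale_lfunE linearZ /= lfunE; apply: mulrC.
rewrite E eqxx scale1r big1 ?addr0 // => j /negPf neq_ji.
by rewrite E neq_ji scale0r.
Qed.

End DualBasis.

Section KcomplexExact.
Variables (k : fieldType) (A : comAlgType k) (gr : nat -> A -> Prop).
Variables (n : nat) (x : 'I_n -> A) (Q2 : {vspace tensor k n 2}).
Variables (E : {set 'I_n}) (e : nat).

Local Notation K := (Kcomplex x Q2 E e).

(** The row vectors of [Kcomplex] are coordinates in a basis of functionals on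
    [B_d]; this is the function on words which they stand for. The lemmas below
    make it an isomorphism onto the functions satisfying [koszul_tensor],
    compatible with differentials and augmentations. *)
Definition row_tensor d (v : 'rV[A]_(\dim {: Bdual Q2 E d})) (w : seq 'I_n) : A :=
  \sum_(i < \dim {: Bdual Q2 E d}) (vbasis {: Bdual Q2 E d})`_i (Bword Q2 E d w) *: v 0 i.

Lemma koszul_row_tensor d (v : 'rV[A]_(\dim {: Bdual Q2 E d})) :
  koszul_tensor Q2 E d (row_tensor v).
Proof.
apply: koszul_tensor_sum => i.
pose f b : A := (vbasis {: Bdual Q2 E d})`_i b *: v 0 i.
have lin_f : linear f by move=> c a b; rewrite /f linearP scalerDl scalerA.
exact: koszul_tensor_comp lin_f (koszul_tensor_Bword Q2 E d).
Qed.

Lemma row_tensor_surj d (z : seq 'I_n -> A) :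
  koszul_tensor Q2 E d z ->
  exists v : 'rV[A]_(\dim {: Bdual Q2 E d}), forall w, size w = d -> row_tensor v w = z w.
Proof.
case/koszul_tensor_lift => h [lin_h zh].
exists (\row_i \sum_(m < \dim {: Bmod Q2 E d})
  dual_coord i m *: h (vbasis {: Bmod Q2 E d})`_m) => w sz.
rewrite zh // -(dual_coord_eval _ lin_h); apply: eq_bigr => i _.
by rewrite mxE.
Qed.

Lemma row_tensor_inj d (v v' : 'rV[A]_(\dim {: Bdual Q2 E d})) :
  (forall w, size w = d -> row_tensor v w = row_tensor v' w) -> v = v'.
Proof.
move=> eq_vv'.
have ev b : \sum_(i < \dim {: Bdual Q2 E d}) (vbasis {: Bdual Q2 E d})`_i b *: v 0 i
          = \sum_(i < \dim {: Bdual Q2 E d}) (vbasis {: Bdual Q2 E d})`_i b *: v' 0 i.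
  have [g ->] : exists g, b = Bclass Q2 E d g.
    exists (quotv_repr _ (quotv_repr _ b)); by rewrite comp_lfunE !quotv_reprK.
  rewrite [g]word_tensor_span !linear_sum.
  pose F (v : 'rV[A]_(\dim {: Bdual Q2 E d})) (b : Bmod Q2 E d) : A :=
    \sum_(i < \dim {: Bdual Q2 E d}) (vbasis {: Bdual Q2 E d})`_i b *: v 0 i.
  have lin_F u : linear (F u).
    move=> c a a'; rewrite /F scaler_sumr -big_split; apply: eq_bigr => i _.
    by rewrite linearP scalerDl scalerA.
  rewrite -/(F v _) -/(F v' _); under eq_bigr do rewrite linearZ.
  rewrite !(linear_sum_scale (lin_F _)); apply: eq_bigr => u _.
  by congr (_ *: _); apply: eq_vv'; rewrite size_tuple.
apply/rowP => i; rewrite -(dual_coordK (v 0)) -(dual_coordK (v' 0)).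
by apply: eq_bigr => m _; rewrite ev.
Qed.

Lemma row_tensor_dif d (v : 'rV[A]_(rk K d.+1)) w :
  row_tensor (v *m dif K d : 'rV[A]_(\dim {: Bdual Q2 E d})) w =
  koszul_diff x (row_tensor (d := d.+1) v) w.
Proof.
rewrite /row_tensor /koszul_diff; under [RHS]eq_bigr do rewrite mulr_sumr.
rewrite [RHS]exchange_big /=.
transitivity (\sum_(j < \dim {: Bdual Q2 E d}) \sum_(i < \dim {: Bdual Q2 E d.+1}) \sum_s
  ((vbasis {: Bdual Q2 E d})`_j (Bword Q2 E d w) *
   coord (vbasis {: Bdual Q2 E d}) j (Bdual_act (vbasis {: Bdual Q2 E d.+1})`_i s))
   *: (v 0 i * x s)).
  apply: eq_bigr => j _; rewrite mxE scaler_sumr; apply: eq_bigr => i _.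
  rewrite mxE summxE mulr_sumr scaler_sumr; apply: eq_bigr => s _.
  by rewrite mxE -scalerAr scalerA.
rewrite [LHS]exchange_big /=; apply: eq_bigr => i _.
rewrite [LHS]exchange_big /=; apply: eq_bigr => s _.
rewrite -scaler_suml -scalerAr [x s * _]mulrC; congr (_ *: _).
pose act := Bdual_act (vbasis {: Bdual Q2 E d.+1})`_i s.
transitivity (act (Bword Q2 E d w)); last by rewrite comp_lfunE Bmod_lmul_word.
rewrite [in RHS](coord_vbasis (memvf act)) sum_lfunE; apply: eq_bigr => j _.
by rewrite scale_lfunE [LHS]mulrC.
Qed.

Lemma row_tensor_aug (v : 'rV[A]_(rk K 0)) :
  (v *m aug K) 0 0 = row_tensor (d := 0) v [::].
Proof.
rewrite mxE; apply: eq_bigr => i _; rewrite mxE -Bmod_one_word.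
by rewrite mulrC mulr_algl.
Qed.

Hypothesis sg : standard_graded gr x.
Hypothesis rel2 : quadratic_relations x Q2.

Lemma Kcomplex_dif_dif d : dif K d.+1 *m dif K d = 0.
Proof.
apply/row_matrixP => i; rewrite row_mul row0.
apply: row_tensor_inj => w sz; rewrite row_tensor_dif.
transitivity (koszul_diff x (koszul_diff x (row_tensor (d := d.+2) (delta_mx 0 i))) w).
  by apply: eq_bigr => s _; rewrite rowE row_tensor_dif.
rewrite (koszul_diffK rel2 (koszul_row_tensor _) sz) /row_tensor big1 // => j _.
by rewrite mxE scaler0.
Qed.

Lemma Kcomplex_homog d s t :
  homog_coef gr (sh (a := K) (d := d.+1) s) (sh (a := K) (d := d) t) (dif K d s t).
Proof.
rewrite /homog_coef /= addSn leqW // subSn // subnn mxE summxE.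
apply: (gr_sum sg) => i _; rewrite mxE.
by apply: (gr_scale sg); apply: (sg_var sg).
Qed.

Hypothesis colon_var : forall (Y : {set 'I_n}) i, i \notin Y ->
  exists Z, same_ideal (colon (var_ideal x Y) (x i)) (var_ideal x Z).

Theorem Kcomplex_resolves : resolves K (var_ideal x E).
Proof.
split=> [a|v|d v vd0].
- have [|v vE] := @row_tensor_surj 0 (fun=> a); first by split=> // u v p _ /=.
  exists v; rewrite row_tensor_aug vE // subrr; exact: ideal_gen0.
- split=> [Ev|[w ->]]; last first.
    rewrite row_tensor_aug row_tensor_dif.
    exact: (koszul_tensor_diff_cycle (d := 0) rel2 (koszul_row_tensor _)).
  rewrite row_tensor_aug in Ev.
  have [z [Kz zE]] := koszul_strand_exact sg rel2 colon_var (koszul_row_tensor v) Ev.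
  have [w wE] := row_tensor_surj Kz; exists w; apply: row_tensor_inj => u sz.
  rewrite zE // row_tensor_dif; apply: eq_bigr => s _.
  by rewrite wE //= sz.
- have cv : koszul_cycle x E d.+1 (row_tensor (d := d.+1) v).
    move=> w sz; rewrite -row_tensor_dif vd0 /row_tensor big1 // => i _.
    by rewrite mxE scaler0.
  have [z [Kz zE]] := koszul_strand_exact sg rel2 colon_var (koszul_row_tensor _) cv.
  have [w wE] := row_tensor_surj Kz; exists w; apply: row_tensor_inj => u sz.
  rewrite zE // row_tensor_dif; apply: eq_bigr => s _.
  by rewrite wE //= sz.
Qed.

End KcomplexExact.

(** * Comparison maps and mapping cones of resolutions *)

Section Cones.
Variables (k : fieldType) (A : comAlgType k) (gr : nat -> A -> Prop).
Variables (n : nat) (x : 'I_n -> A).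
Hypothesis sg : standard_graded gr x.

Lemma homog_coef_mul p q q' a b :
  homog_coef gr p q a -> homog_coef gr q q' b -> homog_coef gr p q' (a * b).
Proof.
rewrite /homog_coef; case: (leqP q p) => [le_qp ga|_ ->]; last first.
  by rewrite mul0r => _; case: ifP => // _; apply: (sg_zero sg).
case: (leqP q' q) => [le_q'q gb|_ ->]; last first.
  by rewrite mulr0; case: ifP => // _; apply: (sg_zero sg).
rewrite (leq_trans le_q'q le_qp).
have -> : (p - q' = (p - q) + (q - q'))%N by rewrite addnBA // subnK.
exact: (sg_mul sg).
Qed.

Lemma homog_coef_sum p q (I : finType) (F : I -> A) :
  (forall i, homog_coef gr p q (F i)) -> homog_coef gr p q (\sum_i F i).
Proof.
move=> hF; elim/big_ind: _ => //; first exact: (homog_coef0 sg).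
exact: (homog_coef_add sg).
Qed.

Lemma homog_coef_max_ideal p q a :
  homog_coef gr p q a -> (q < p)%N -> max_ideal x a.
Proof.
rewrite /homog_coef => + lt_qp; rewrite (ltnW lt_qp) -(subnSK lt_qp).
exact: (gr_max_ideal sg).
Qed.

Section Comparison.
Variables (F K : augcomplex A) (J : A -> Prop) (m : A) (e : nat).
Hypothesis grF : graded_complex gr F.
Hypothesis resF : resolves F J.
Hypothesis homK : forall d s t,
  homog_coef gr (sh (a := K) (d := d.+1) s) (sh (a := K) (d := d) t) (dif K d s t).
Hypothesis difK : forall d, dif K d.+1 *m dif K d = 0.

Definition homog_matrix d (M : 'M[A]_(rk K d, rk F d)) : Prop :=
  forall s t, homog_coef gr (sh (a := K) s) (sh (a := F) t) (M s t).

(** The condition under which the chain map extends one degree further. *)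
Definition sends_boundaries d (M : 'M[A]_(rk K d, rk F d)) : Prop :=
  forall v : 'rV[A]_(rk K d.+1), exists w, v *m dif K d *m M = w *m dif F d.

(** Solving a homogeneous equation does not leave the homogeneous vectors:
    truncate the coordinates of any solution to the right degrees. *)
Lemma homog_preimage d p (w : 'rV[A]_(rk F d.+1)) :
  (forall t, homog_coef gr p (sh (a := F) t) ((w *m dif F d) 0 t)) ->
  exists w' : 'rV[A]_(rk F d.+1), (forall t, homog_coef gr p (sh (a := F) t) (w' 0 t)) /\
    w' *m dif F d = w *m dif F d.
Proof.
move=> hw; exists (\row_t hpart gr p (sh (a := F) t) (w 0 t)); split=> [t|].
  by rewrite mxE; apply: (homog_hpart sg).
case: grF => hF _ _; apply/rowP => u; rewrite -(hpart_id sg (hw u)) !mxE.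
rewrite /hpart; case: ifP => le_up; last first.
  rewrite big1 // => t _; rewrite mxE; have := hpart_mul sg p (w 0 t) (hF d t u).
  by rewrite {1}/hpart le_up => <-.
rewrite (component_sum sg); apply: eq_bigr => t _.
by rewrite mxE -(hpart_mul sg p (w 0 t) (hF d t u)) /hpart le_up.
Qed.

Lemma comparison_step d (M : 'M[A]_(rk K d, rk F d)) :
  homog_matrix M -> sends_boundaries M ->
  exists M' : 'M[A]_(rk K d.+1, rk F d.+1),
    [/\ M' *m dif F d = dif K d *m M, homog_matrix M' & sends_boundaries M'].
Proof.
move=> hM bM.
have row_ex s : exists w : 'rV[A]_(rk F d.+1),
    (forall t, homog_coef gr (sh (a := K) s) (sh (a := F) t) (w 0 t)) /\
    w *m dif F d = row s (dif K d *m M).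
  have [w wE] := bM (delta_mx 0 s).
  have rE : row s (dif K d *m M) = w *m dif F d by rewrite rowE mulmxA.
  rewrite rE; apply: homog_preimage => t; rewrite -rE !mxE.
  by apply: homog_coef_sum => j; apply: homog_coef_mul (homK _ _) (hM _ _).
have [w wP] := fin_all_exists row_ex; exists (\matrix_s w s).
have E : (\matrix_s w s) *m dif F d = dif K d *m M.
  by apply/row_matrixP => s; rewrite row_mul rowK; case: (wP s).
split=> // [s t|v]; first by rewrite mxE; case: (wP s).
case: resF => _ _; apply.
by rewrite -!mulmxA E (mulmxA (dif K d.+1)) difK mul0mx mulmx0.
Qed.

Hypothesis gm : gr e m.
Hypothesis shK : forall s, sh (a := K) (d := 0) s = e.
Hypothesis augK : forall s, gr 0 (aug K s 0).
Hypothesis difaugK : forall v : 'rV[A]_(rk K 1), J ((v *m dif K 0 *m aug K) 0 0 * m).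
Hypothesis J0 : J 0.
Hypothesis shF : forall s, sh (a := F) (d := 0) s = 0%N.
Variable u : 'rV[A]_(rk F 0).
Hypothesis gu : forall t, gr 0 (u 0 t).
Hypothesis augu : (u *m aug F) 0 0 = 1.

(** The comparison theorem for free complexes, in its graded form. [K 0] is sent
    to [F 0] by [m] times the augmentation followed by the element [u] of
    augmentation 1, and the further maps are chosen degree by degree. *)
Lemma comparison : exists psi : forall d, 'M[A]_(rk K d, rk F d), lifts_mul gr J m psi.
Proof.
pose psi0 := m *: (aug K *m u).
have psi0E q (v : 'M[A]_(q, rk K 0)) i : (v *m psi0 *m aug F) i 0 = m * (v *m aug K) i 0.
  rewrite /psi0 -scalemxAr -scalemxAl mxE; congr (_ * _).
  have -> : v *m (aug K *m u) *m aug F = (v *m aug K) *m (u *m aug F) by rewrite !mulmxA.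
  by rewrite mxE big_ord1 augu mulr1.
have h0 : homog_matrix psi0.
  move=> s t; rewrite /homog_coef shK shF leq0n subn0 !mxE big_ord1.
  rewrite -[e]addn0; apply: (sg_mul sg) => //; rewrite -[0%N]/(0 + 0)%N.
  exact: (sg_mul sg).
have b0 : sends_boundaries psi0.
  by move=> v; case: resF => _ bF _; apply/bF; rewrite psi0E mulrC.
pose T d := {M : 'M[A]_(rk K d, rk F d) | homog_matrix M /\ sends_boundaries M}.
have next d (M : T d) : {M' : T d.+1 | sval M' *m dif F d = dif K d *m sval M}.
  apply: constructive_indefinite_description; case: M => M [hM bM] /=.
  have [M' [E hM' bM']] := comparison_step hM bM.
  by exists (exist _ M' (conj hM' bM')).
pose fix psi d : T d :=
  if d is d'.+1 then sval (next d' (psi d')) else exist _ psi0 (conj h0 b0).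
exists (fun d => sval (psi d)); split=> [d s t|d|v].
- by case: (svalP (psi d)) => hM _; apply: hM.
- exact: (svalP (next d (psi d))).
- by rewrite /= psi0E subrr.
Qed.

End Comparison.

Section ConeResolves.
Variables (F K : augcomplex A) (J : A -> Prop) (m : A).
Variable psi : forall d, 'M[A]_(rk K d, rk F d).
Hypothesis resF : resolves F J.
Hypothesis resK : resolves K (colon J m).
Hypothesis difK : forall d, dif K d.+1 *m dif K d = 0.
Hypothesis lift_psi : lifts_mul gr J m psi.
Hypothesis J0 : J 0.
Hypothesis JD : forall c a b, J a -> J b -> J (c * a + b).

(** The long exact sequence of the cone, for the short exact sequence
    [0 -> A/(J : m) -> A/J -> A/(J + A m) -> 0], spelled out on elements. *)
Lemma cone_resolves : resolves (mapping_cone psi) (fun a => exists c, J (a - c * m)).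
Proof.
have [surjF exF0 exF] := resF; have [surjK exK0 exK] := resK.
have [_ psiE psi_aug] := lift_psi.
have JN a : J a -> J (- a) by move=> Ja; rewrite -[- a]addr0 -mulN1r; apply: JD.
have JA a b : J a -> J b -> J (a + b) by move=> Ja Jb; rewrite -[a]mul1r; apply: JD.
have JM c a : J a -> J (c * a) by move=> Ja; rewrite -[c * a]addr0; apply: JD.
have addaug (v v' : 'rV[A]_(rk F 0)) :
  ((v + v') *m aug F) 0 0 = (v *m aug F) 0 0 + (v' *m aug F) 0 0 by rewrite mulmxDl mxE.
split=> [a|v|d v vd0].
- by have [v Jv] := surjF a; exists v, 0; rewrite mul0r subr0.
- split=> [[c Jc]|[w ->]].
    have [u Ju] := surjK c.
    have [|w wE] := (exF0 (v - u *m psi 0%N)).1.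
      rewrite addaug mulNmx [X in _ + X]mxE.
      have -> : (v *m aug F) 0 0 - (u *m psi 0%N *m aug F) 0 0 =
        ((v *m aug F) 0 0 - c * m) +
        ((c - (u *m aug K) 0 0) * m + - ((u *m psi 0%N *m aug F) 0 0 - m * (u *m aug K) 0 0)).
        by ring.
      by apply: (JA _ _) => //; apply: (JA _ _) => //; apply/JN/psi_aug.
    exists (row_mx w u); rewrite /= mul_row_col -wE subrK //.
  rewrite -[w]hsubmxK /= mul_row_col; move: (lsubmx _) (rsubmx _) => w1 w2.
  exists ((w2 *m aug K) 0 0); rewrite addaug -addrA; apply: (JA _ _).
    by apply/exF0; exists w1.
  by rewrite [_ * m]mulrC; apply: psi_aug.
- case: d v vd0 => [|d] v; rewrite -[v]hsubmxK; move: (lsubmx v) (rsubmx v) => v1 v2 /=.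
    rewrite mul_row_col => vd0.
    have [|w wE] := (exK0 v2).1.
      rewrite /colon mulrC.
      have -> : m * (v2 *m aug K) 0 0 =
          (v2 *m psi 0%N *m aug F) 0 0
          - ((v2 *m psi 0%N *m aug F) 0 0 - m * (v2 *m aug K) 0 0) by rewrite opprB addrC subrK.
      apply: (JA _ _); last exact/JN/psi_aug.
      have -> : v2 *m psi 0%N = (- v1) *m dif F 0.
        by apply/eqP; rewrite mulNmx -addr_eq0 addrC vd0.
      by apply/exF0; exists (- v1).
    have [|w' w'E] := exF 0%N (v1 + w *m psi 1%N).
      by rewrite mulmxDl -mulmxA psiE mulmxA -wE.
    (* The sign is that of [- dif K] in the cone. *)
    exists (row_mx w' (- w)); rewrite mul_row_block mulmx0 add0r mulNmx mulmxN mulNmx opprK.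
    by rewrite -wE -w'E addrK.
  rewrite mul_row_block mulmx0 add0r -[0]row_mx0 => /eq_row_mx[vd0 /eqP].
  rewrite mulmxN oppr_eq0 => /eqP /exK[w wE].
  have [|w' w'E] := exF d.+1 (v1 + w *m psi d.+2).
    by rewrite mulmxDl -mulmxA psiE mulmxA -wE.
  exists (row_mx w' (- w)); rewrite mul_row_block mulmx0 add0r mulNmx mulmxN mulNmx opprK.
  by rewrite -wE -w'E addrK.
Qed.

Hypothesis grF : graded_complex gr F.
Hypothesis homK : forall d s t,
  homog_coef gr (sh (a := K) (d := d.+1) s) (sh (a := K) (d := d) t) (dif K d s t).

Lemma cone_graded : graded_complex gr (mapping_cone psi).
Proof.
have [homF augF difF] := grF; have [homp psiE _] := lift_psi.
split=> [[|d] s t|//|[|d]] /=.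
- by rewrite mxE; case: (split s) => s'.
- rewrite !mxE; case: (split s) => s'; rewrite mxE; case: (split t) => t' //.
    by rewrite mxE; apply: (homog_coef0 sg).
  by rewrite mxE; apply: (homog_coef_opp sg).
- by rewrite mul_block_col !mul0mx difF psiE mulNmx addrN addr0 col_mx0.
- rewrite mulmx_block !mulmx0 !mul0mx !difF psiE mulmxN !mulNmx opprK difK.
  by rewrite addrN !addr0 block_mx0.
Qed.

Lemma cone_minimal : minimal_complex x F ->
  (forall d s t, max_ideal x (dif K d s t)) ->
  (forall d s t, max_ideal x (psi d s t)) ->
  minimal_complex x (mapping_cone psi).
Proof.
move=> minF minK minpsi [|d] s t /=; first by rewrite mxE; case: (split s) => s'.
rewrite mxE; case: (split s) => s'; rewrite mxE; case: (split t) => t' //; rewrite mxE.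
  exact: ideal_gen0.
exact/ideal_genN/minK.
Qed.

End ConeResolves.
End Cones.

(** * Iterated mapping cones *)

Section Iterated.
Variables (k : fieldType) (A : comAlgType k) (gr : nat -> A -> Prop).
Variables (n : nat) (x : 'I_n -> A) (Q2 : {vspace tensor k n 2}).
Variables (r : nat) (mu : r.-tuple 'X_{1..n}).
Hypothesis sg : standard_graded gr x.
Hypothesis rel2 : quadratic_relations x Q2.
Hypothesis colon_var : forall (Y : {set 'I_n}) i, i \notin Y ->
  exists Z, same_ideal (colon (var_ideal x Y) (x i)) (var_ideal x Z).

(** Divide by the variables of the monomial one at a time: each step turns an
    ideal of variables into another one, unless the variable belongs to it, in
    which case so does the monomial to [(Y)]. *)
Lemma colon_monomial (Y : {set 'I_n}) (u : 'X_{1..n}) :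
  var_ideal x Y (mmap1 x u) \/
  exists Z, same_ideal (colon (var_ideal x Y) (mmap1 x u)) (var_ideal x Z).
Proof.
pose P m := forall Y : {set 'I_n}, var_ideal x Y m \/
  exists Z, same_ideal (colon (var_ideal x Y) m) (var_ideal x Z).
suff : P (mmap1 x u) by apply.
have P1 : P 1 by move=> {}Y; right; exists Y => a; rewrite /colon mulr1.
have PM a b : P a -> P b -> P (a * b).
  move=> Pa Pb {}Y; have [aY|[Z aZ]] := Pa Y; first by left; rewrite mulrC; apply: ideal_genM.
  have colE c : colon (var_ideal x Y) (a * b) c <-> colon (var_ideal x Z) b c.
    by rewrite /colon mulrCA mulrC; apply: aZ.
  have [bZ|[Z' bZ']] := Pb Z; first by left; rewrite mulrC; apply/aZ.
  by right; exists Z' => c; rewrite -(bZ' c).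
have Px i : P (x i).
  move=> {}Y; have [iY|iY] := boolP (i \in Y); last by right; apply: colon_var.
  by left; apply: ideal_gen_gen.
rewrite /mmap1; elim/big_ind: _ => // i _.
by elim: (u i) => [|m IHm]; [rewrite expr0 | rewrite exprS; apply: PM].
Qed.

Lemma partial_idealS i : (i < r)%N ->
  same_ideal (partial_ideal x mu i.+1)
    (fun a => exists c, partial_ideal x mu i (a - c * mon x mu i)).
Proof.
move=> lt_ir a; split=> [[c ->]|[c [b abE]]].
  exists (c (Ordinal lt_ir)); rewrite (bigD1 (Ordinal lt_ir)) //= addrC addrK.
  apply: ideal_gen_sum => j /andP[le_ji neq_ji]; apply: ideal_genM.
  apply: (ideal_gen_gen (fun j : 'I_r => mon x mu j)).
  by rewrite ltn_neqAle neq_ji.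
rewrite -[a](subrK (c * mon x mu i)); apply: ideal_genD.
  rewrite abE; apply: ideal_gen_sum => j lt_ji; apply: ideal_genM.
  by apply: (ideal_gen_gen (fun j : 'I_r => mon x mu j)); apply: ltnW.
by apply: ideal_genM; apply: (ideal_gen_gen (fun j : 'I_r => mon x mu j) (i := Ordinal lt_ir)).
Qed.

Lemma resolves_same (F : augcomplex A) (J J' : A -> Prop) :
  same_ideal J J' -> resolves F J -> resolves F J'.
Proof.
move=> eqJ [sF bF eF]; split=> // [a|v].
  by have [v Jv] := sF a; exists v; apply/eqJ.
by split=> [/eqJ/bF//|/bF/eqJ].
Qed.

Hypothesis proper : ~ partial_ideal x mu r 1.
Hypothesis deg_mono :
  forall i j, (i <= j < r)%N -> (mon_deg mu i <= mon_deg mu j)%N.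

Lemma mon_deg_gt0 i : (i < r)%N -> (0 < mon_deg mu i)%N.
Proof.
move=> lt_ir; rewrite lt0n mdeg_eq0; apply/eqP => u0; case: proper.
have := ideal_gen_gen (fun j : 'I_r => mon x mu j) (P := fun j : 'I_r => (j < r)%N)
  (i := Ordinal lt_ir) lt_ir.
by rewrite /mon /= u0 mmap11.
Qed.

Lemma gr_mon i : gr (mon_deg mu i) (mon x mu i).
Proof. exact: (gr_monomial sg). Qed.

(** The last field makes the next comparison maps minimal: the strand of a later
    generator [j] is mapped to [F_(l+1)] from its own degree [l + 1], whose basis
    elements have degree [l + 1 + mon_deg mu j]. *)
Record cone_invariant (i : nat) (F : augcomplex A) : Prop := ConeInvariant {
  inv_graded : graded_complex gr F;
  inv_resolves : resolves F (partial_ideal x mu i);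
  inv_minimal : minimal_complex x F;
  inv_sh0 : forall s, sh (a := F) (d := 0) s = 0%N;
  inv_unit : exists u : 'rV[A]_(rk F 0), (forall t, gr 0 (u 0 t)) /\ (u *m aug F) 0 0 = 1;
  inv_shS : forall l s j, (i <= j < r)%N -> (sh (a := F) (d := l.+1) s <= l + mon_deg mu j)%N
}.

Lemma gr1 : gr 0 1.
Proof. by rewrite -[1]scale1r; apply: (gr_scalar sg). Qed.

Lemma cone_invariant0 : cone_invariant 0 (base_complex A).
Proof.
split=> //.
- split=> [d s t|s|d]; rewrite ?mulmx0 //; first by rewrite mxE; apply: (homog_coef0 sg).
  by rewrite mxE; apply: gr1.
- have augE (v : 'rV[A]_1) : (v *m const_mx 1 : 'M_1) 0 0 = v 0 0.
    by rewrite mxE big_ord1 mxE mulr1.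
  have J0 a : partial_ideal x mu 0 a <-> a = 0.
    by split=> [[c ->]|->]; [rewrite big_pred0 | apply: ideal_gen0].
  split=> [a|v|d v _]; last by exists 0; apply/matrixP => i [].
    exists (const_mx a : 'rV_1); apply/J0; rewrite /= augE mxE; exact: subrr.
  rewrite J0 /= augE; split=> [v0|[w ->]]; last by rewrite mulmx0 mxE.
  by exists 0; rewrite mulmx0; apply/rowP => i; rewrite !mxE ord1.
- by move=> d s t; rewrite mxE; apply: ideal_gen0.
- exists (const_mx 1 : 'rV_1); split=> [t|]; first by rewrite mxE; apply: gr1.
  by rewrite mxE big_ord1 !mxE mulr1.
Qed.

Section Step.
Variables (E : {set 'I_n}) (i : nat) (F : augcomplex A).
Hypothesis lt_ir : (i < r)%N.
Hypothesis colE : same_ideal (colon (partial_ideal x mu i) (mon x mu i)) (var_ideal x E).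
Hypothesis invF : cone_invariant i F.

Local Notation K := (Kcomplex x Q2 E (mon_deg mu i)).

Lemma Kcomplex_resolves_colon : resolves K (colon (partial_ideal x mu i) (mon x mu i)).
Proof.
apply: (resolves_same (J := var_ideal x E)) => [a|]; first by split=> /colE.
exact: (Kcomplex_resolves E (mon_deg mu i) sg rel2 colon_var).
Qed.

Lemma cone_lift_ex :
  exists psi : forall d, 'M[A]_(rk K d, rk F d),
    lifts_mul gr (partial_ideal x mu i) (mon x mu i) psi.
Proof.
have [grF resF _ shF [u [gu augu]] _] := invF.
apply: (@comparison _ _ gr n x sg F K _ _ (mon_deg mu i) grF resF
  _ _ _ _ _ _ _ shF u gu augu) => //.
- by move=> d s t; apply: Kcomplex_homog.
- by move=> d; apply: Kcomplex_dif_dif rel2 d.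
- exact: gr_mon.
- by move=> s; rewrite mxE; apply: (gr_scalar sg).
- move=> v; have [_ exK _] := Kcomplex_resolves_colon.
  by apply/exK; exists v.
- exact: ideal_gen0.
Qed.

Lemma cone_invariantS (psi : forall d, 'M[A]_(rk K d, rk F d)) :
  lifts_mul gr (partial_ideal x mu i) (mon x mu i) psi ->
  cone_invariant i.+1 (mapping_cone psi).
Proof.
move=> lift_psi; have [grF resF minF shF unitF shSF] := invF.
have homK d s t : homog_coef gr (sh (a := K) s) (sh (a := K) t) (dif K d s t).
  exact: Kcomplex_homog.
have difK d : dif K d.+1 *m dif K d = 0 by apply: Kcomplex_dif_dif.
have [homp _ _] := lift_psi.
split=> //.
- exact: (cone_graded sg difK lift_psi grF homK).
- apply: (resolves_same (J := fun a => exists c, partial_ideal x mu i (a - c * mon x mu i))).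
    by move=> a; split=> /partial_idealS; apply.
  apply: cone_resolves lift_psi _ _ => //; first exact: Kcomplex_resolves_colon.
    exact: ideal_gen0.
  by move=> c a b; apply: ideal_gen_lin.
- apply: cone_minimal => // d s t.
    by apply: (homog_coef_max_ideal sg (homK d s t)); rewrite /= addSn.
  apply: (homog_coef_max_ideal sg (homp d s t)).
  case: d s t => [|d] s t; first by rewrite shF mon_deg_gt0.
  by rewrite [X in (_ < X)%N]/= addSn ltnS shSF // leqnn.
- move=> l s j /andP[lt_ij lt_jr] /=; case: (split s) => s'.
    by apply: shSF; rewrite (ltnW lt_ij).
  by rewrite leq_add2l deg_mono // (ltnW lt_ij).
Qed.

End Step.

Lemma iterated_cone_invariant (E : nat -> {set 'I_n})
    (psi : forall j F d, 'M[A]_(rk (KE x mu Q2 E j) d, rk F d)) i :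
  (i <= r)%N -> colon_vars x mu E ->
  (forall j, (j < i)%N -> lifts_mul gr (partial_ideal x mu j) (mon x mu j)
     (psi j (iterated_cone psi j))) ->
  cone_invariant i (iterated_cone psi i).
Proof.
elim: i => [|i IHi] le_ir colE lift_psi; first exact: cone_invariant0.
apply: cone_invariantS (lift_psi i _) => //; first exact: colE.
by apply: IHi => // [|j lt_ji]; [apply: ltnW | apply/lift_psi/ltnW].
Qed.

Hypothesis mingen : minimal_generators x mu.
Hypothesis linquo : linear_quotients x mu.

(** Linear quotients provide the sets for all but the first generator, whose
    annihilator is a colon ideal of the zero ideal by a monomial. *)
Lemma colon_vars_ex : exists E, colon_vars x mu E.
Proof.
have ex i : exists Z : {set 'I_n}, (i < r)%N ->
    same_ideal (colon (partial_ideal x mu i) (mon x mu i)) (var_ideal x Z).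
  have [lt_ir|_] := ltnP i r; last by exists set0.
  case: i lt_ir => [|i] lt_ir; last by have [Z colZ] := linquo (i := i.+1) lt_ir; exists Z.
  have [m0|[Z colZ]] := colon_monomial set0 (nth 0%MM mu 0).
    case: (mingen (i := Ordinal lt_ir)); case: m0 => c m0; exists (fun=> 0).
    rewrite {1}/mon /= m0 !big1 // => [j _|j]; first by rewrite mul0r.
    by rewrite /= inE.
  exists Z => _ a; rewrite -(colZ a) /colon; move: (a * _) => b.
  by split=> -[c ->]; exists (fun=> 0); rewrite !big_pred0 // => j; rewrite /= inE.
exists (fun i => epsilon (inhabits set0) (fun Z => (i < r)%N ->
  same_ideal (colon (partial_ideal x mu i) (mon x mu i)) (var_ideal x Z))).
by move=> i; apply: (epsilon_spec (inhabits set0) _ (ex i)).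
Qed.

(** A lift is chosen for every pair of complexes between which there is one. By
    induction on [j], this is the case for the cone built from the first [j]
    strands, as only earlier choices enter it. *)
Lemma cone_data_ex : exists (E : nat -> {set 'I_n})
  (psi : forall j F d, 'M[A]_(rk (KE x mu Q2 E j) d, rk F d)), cone_data gr psi.
Proof.
have [E colE] := colon_vars_ex; exists E.
pose psi j F : forall d, 'M[A]_(rk (KE x mu Q2 E j) d, rk F d) :=
  epsilon (inhabits (fun d => 0)) (lifts_mul gr (partial_ideal x mu j) (mon x mu j)).
exists psi; split=> // j; elim/ltn_ind: j => j IHj lt_jr.
apply: epsilon_spec; apply: cone_lift_ex => //; first exact: colE.
apply: iterated_cone_invariant => // [|i lt_ij]; first exact: ltnW.
by apply: IHj => //; apply: ltn_trans lt_jr.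
Qed.

End Iterated.

(** * Bases of the iterated cone *)

Section ConformMx.
Variables (R : nzRingType) (m n m' n' : nat).

Lemma conform_mx_linear : linear (conform_mx 0 : 'M[R]_(m, n) -> 'M[R]_(m', n')).
Proof.
move=> c a b; have [eqm|neqm] := eqVneq m m'; last first.
  by rewrite !nonconform_mx ?neqm // scaler0 addr0.
have [eqn|neqn] := eqVneq n n'; last first.
  by rewrite !nonconform_mx ?neqn ?orbT // scaler0 addr0.
by case: m' / eqm; case: n' / eqn; rewrite !conform_mx_id.
Qed.

Lemma conform_mx0 : conform_mx (0 : 'M[R]_(m', n')) (0 : 'M[R]_(m, n)) = 0.
Proof.
have := conform_mx_linear (-1) 0 0.
by rewrite scaler0 addr0 scaleN1r addNr.
Qed.

End ConformMx.

Section ConeBasis.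
Variables (k : fieldType) (A : comAlgType k) (K : nat -> augcomplex A).
Variable psi : forall (j : nat) (F : augcomplex A) d, 'M[A]_(rk (K j) d, rk F d).

Local Notation C := (iterated_cone psi).

(** At most one summand is nonzero; [conform_mx] only identifies the strands [i']
    and [j] when the two indices agree. *)
Fixpoint cone_proj (i l : nat) (j : nat) : 'rV[A]_(rk (C i) l.+1) -> 'rV[A]_(rk (K j) l) :=
  match i with
  | 0 => fun _ => 0
  | i'.+1 => fun w =>
      cone_proj j (lsubmx w) + (if j == i' then conform_mx 0 (rsubmx w) else 0)
  end.

Lemma cone_proj_linear i l j : linear (@cone_proj i l j).
Proof.
elim: i => [|i IHi] c a b /=; first by rewrite scaler0 addr0.
have conf := @conform_mx_linear A 1 (rk (K i) l) 1 (rk (K j) l).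
rewrite !linearP /= IHi scalerDr -!addrA; congr (_ + _); rewrite [RHS]addrCA; congr (_ + _).
by case: eqP => _; rewrite ?conf // scaler0 addr0.
Qed.

Lemma cone_incl_linear i l j :
  linear (fun v : 'rV[A]_(rk (K j) l) => cone_incl psi v i).
Proof.
elim: i => [|i IHi] c a b /=; first by rewrite scaler0 addr0.
have conf := @conform_mx_linear A 1 (rk (K j) l) 1 (rk (K i) l).
rewrite IHi scale_row_mx add_row_mx; congr row_mx.
by case: eqP => _; rewrite ?conf // scaler0 addr0.
Qed.

Lemma cone_incl_small i l j (v : 'rV[A]_(rk (K j) l)) :
  (i <= j)%N -> cone_incl psi v i = 0.
Proof.
elim: i => //= i IHi lt_ij; rewrite IHi ?(ltnW lt_ij) //.
by rewrite gtn_eqF // row_mx0.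
Qed.

Lemma cone_proj_incl i l j j' (v : 'rV[A]_(rk (K j) l)) :
  cone_proj j' (cone_incl psi v i) =
  if (j < i)%N && (j' == j) then conform_mx 0 v else 0.
Proof.
elim: i => //= i IHi; rewrite row_mxKl row_mxKr IHi ltnS {IHi}.
have [eq_ji|neq_ji] := eqVneq j i.
  case: i / eq_ji; rewrite ltnn leqnn /= add0r.
  by case: eqP => // _; rewrite conform_mx_id.
by rewrite conform_mx0 if_same addr0 [(j < i)%N]ltn_neqAle neq_ji.
Qed.

Lemma cone_proj_sum i l (w : 'rV[A]_(rk (C i) l.+1)) :
  w = \sum_(j < i) cone_incl psi (cone_proj j w) i.
Proof.
elim: i w => [|i IHi] w; first by rewrite big_ord0; apply/matrixP => a [].
rewrite big_ord_recr /= eqxx.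
have proj0 : cone_proj i (lsubmx w) = 0 :> 'rV_(rk (K i) l).
  rewrite [lsubmx w]IHi.
  have lin := @cone_proj_linear i l i.
  have add0 : cone_proj i (0 : 'rV[A]_(rk (C i) l.+1)) = 0.
    by have := lin (-1) 0 0; rewrite scaler0 addr0 scaleN1r addNr.
  elim/big_ind: _ => // [a b a0 b0|j _].
    by have := lin 1 a b; rewrite !scale1r a0 b0 addr0.
  by rewrite cone_proj_incl ltn_ord gtn_eqF.
rewrite proj0 add0r !conform_mx_id cone_incl_small // -[LHS]hsubmxK.
transitivity (row_mx (lsubmx w) 0 + row_mx 0 (rsubmx w)).
  by rewrite add_row_mx addr0 add0r.
congr (_ + _); rewrite {1}[lsubmx w]IHi.
have -> : row_mx (\sum_(j < i) cone_incl psi (cone_proj j (lsubmx w)) i) 0 =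
    \sum_(j < i) row_mx (cone_incl psi (cone_proj j (lsubmx w)) i) 0
    :> 'rV[A]_(rk (C i) l.+1 + rk (K i) l).
  elim/big_rec2: _ => [|j a b _ <-]; first by rewrite row_mx0.
  by rewrite add_row_mx addr0.
by apply: eq_bigr => j _; rewrite ltn_eqF // addr0.
Qed.

End ConeBasis.

Section PureTensorBasis.
Variables (k : fieldType) (A : comAlgType k) (W : vectType k).
Variable f : (\dim {: W}).-tuple W.
Hypothesis basis_f : basis_of {: W} f.

(** The coordinates in the basis [1 (x) f t] of the row vector [v], itself the
    coordinates in the reference basis of [W]. *)
Definition pure_coord (t : 'I_(\dim {: W})) (v : 'rV[A]_(\dim {: W})) : A :=
  \sum_(m < \dim {: W}) coord f t (vbasis {: W})`_m *: v 0 m.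

Lemma pure_tensor_span (v : 'rV[A]_(\dim {: W})) :
  v = \sum_(t < \dim {: W}) pure_coord t v *: pure_tensor 1 (tnth f t).
Proof.
apply/rowP => j; rewrite summxE.
transitivity (\sum_(m < \dim {: W}) coord (vbasis {: W}) j (vbasis {: W})`_m *: v 0 m).
  rewrite (bigD1 j) //= coord_free ?(basis_free (vbasisP _)) // eqxx scale1r.
  rewrite big1 ?addr0 // => m /negPf neq_mj.
  by rewrite coord_free ?(basis_free (vbasisP _)) // neq_mj scale0r.
transitivity (\sum_(m < \dim {: W}) \sum_(t < \dim {: W}) (coord f t (vbasis {: W})`_m *
    coord (vbasis {: W}) j (tnth f t)) *: v 0 m).
  apply: eq_bigr => m _; rewrite -scaler_suml; congr (_ *: _).
  rewrite {1}(coord_basis basis_f (memvf (vbasis {: W})`_m)) linear_sum.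
  by apply: eq_bigr => t _; rewrite linearZ /= (tnth_nth 0).
rewrite exchange_big; apply: eq_bigr => t _; rewrite !mxE mulr_suml.
by apply: eq_bigr => m _; rewrite -scalerAl -scalerAr mulr1 scalerA.
Qed.

Lemma pure_coordK (c : 'I_(\dim {: W}) -> A) t :
  pure_coord t (\sum_(s < \dim {: W}) c s *: pure_tensor 1 (tnth f s)) = c t.
Proof.
transitivity (\sum_(s < \dim {: W}) coord f t (tnth f s) *: c s); last first.
  rewrite (bigD1 t) //= (tnth_nth 0) coord_free ?(basis_free basis_f) // eqxx scale1r.
  rewrite big1 ?addr0 // => s /negPf neq_st.
  by rewrite (tnth_nth 0) coord_free ?(basis_free basis_f) // neq_st scale0r.
transitivity (\sum_(m < \dim {: W}) \sum_(s < \dim {: W}) (coord f t (vbasis {: W})`_m *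
    coord (vbasis {: W}) m (tnth f s)) *: c s).
  apply: eq_bigr => m _; rewrite summxE scaler_sumr; apply: eq_bigr => s _.
  by rewrite !mxE -scalerAr mulr1 scalerA.
rewrite exchange_big; apply: eq_bigr => s _; rewrite -scaler_suml; congr (_ *: _).
rewrite [in RHS](coord_vbasis (memvf (tnth f s))) linear_sum.
by apply: eq_bigr => m _; rewrite linearZ /= mulrC.
Qed.

End PureTensorBasis.

Section IteratedConeBasis.
Variables (k : fieldType) (A : comAlgType k) (n : nat) (x : 'I_n -> A).
Variables (Q2 : {vspace tensor k n 2}) (r : nat) (mu : r.-tuple 'X_{1..n}).
Variables (E : nat -> {set 'I_n}).
Variable psi : forall j (F : augcomplex A) d, 'M[A]_(rk (KE x mu Q2 E j) d, rk F d).

Lemma cone_proj_sum_incl l (u : forall i : 'I_r, 'rV[A]_(rk (KE x mu Q2 E i) l)) (j : 'I_r) :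
  cone_proj j (\sum_(i < r) cone_incl psi (u i) r) = u j.
Proof.
under eq_bigr do rewrite -[cone_incl _ _ _]scale1r.
rewrite linear_sum_scale; last exact: cone_proj_linear.
rewrite (bigD1 j) //= big1 => [|i neq_ij].
  by rewrite scale1r addr0 cone_proj_incl ltn_ord eqxx conform_mx_id.
by rewrite cone_proj_incl ltn_ord val_eqE eq_sym (negPf neq_ij) scaler0.
Qed.

Lemma iterated_cone_basis
    (f : forall i l : nat, (\dim {: Bdual Q2 (E i) l}).-tuple (Bdual Q2 (E i) l)) :
  (forall i l, basis_of {: Bdual Q2 (E i) l} (f i l)) ->
  forall l,
    free_module_basis
      (fun p : {i : 'I_r & 'I_(\dim {: Bdual Q2 (E i) l})} =>
         cone_incl psi
           (pure_tensor 1 (tnth (f (tag p) l) (tagged p)) :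
              'rV[A]_(rk (KE x mu Q2 E (tag p)) l)) r).
Proof.
move=> basis_f l w.
pose e (i : nat) (t : 'I_(\dim {: Bdual Q2 (E i) l})) : 'rV[A]_(rk (KE x mu Q2 E i) l) :=
  pure_tensor 1 (tnth (f i l) t).
pose T := {i : 'I_r & 'I_(\dim {: Bdual Q2 (E i) l})}.
have sumE (c : forall i : 'I_r, 'I_(\dim {: Bdual Q2 (E i) l}) -> A) :
    \sum_(p : T) c (tag p) (tagged p) *: cone_incl psi (e (tag p) (tagged p)) r =
    \sum_(i < r) cone_incl psi (\sum_t c i t *: e i t) r.
  transitivity (\sum_(i < r) \sum_t c i t *: cone_incl psi (e i t) r).
    by rewrite sig_big_dep.
  apply: eq_bigr => i _.
  by rewrite (linear_sum_scale (@cone_incl_linear _ _ _ psi r l i)).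
pose c (i : 'I_r) t := pure_coord (f i l) t (cone_proj (K := KE x mu Q2 E) i w).
exists [ffun p : T => c (tag p) (tagged p)]; split=> [|c' wE].
  transitivity (\sum_(p : T) c (tag p) (tagged p) *: cone_incl psi (e (tag p) (tagged p)) r).
    rewrite sumE {1}[w]cone_proj_sum; apply: eq_bigr => i _.
    have -> : \sum_t c i t *: e i t = cone_proj i w; last by [].
    by symmetry; apply: pure_tensor_span.
  by apply: eq_bigr => p _; rewrite ffunE.
apply/ffunP => -[j t]; rewrite ffunE /c /=.
pose b (i : 'I_r) (t : 'I_(\dim {: Bdual Q2 (E i) l})) : A := c' (existT _ i t).
have -> : w = \sum_(i < r) cone_incl psi (\sum_t b i t *: e i t) r.
  by rewrite -sumE wE; apply: eq_bigr => -[i s] _.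
by rewrite (cone_proj_sum_incl (fun i => \sum_t b i t *: e i t)) pure_coordK.
Qed.

End IteratedConeBasis.

(** * The resolution of a monomial ideal with linear quotients *)

Theorem lemma3p15 (k : fieldType) (A : comAlgType k) (gr : nat -> A -> Prop)
    (n : nat) (x : 'I_n -> A) (Q2 : {vspace tensor k n 2})
    (S : pred 'X_{1..n}) (r : nat) (mu : r.-tuple 'X_{1..n}) :
  standard_graded gr x ->
  strongly_koszul gr x ->
  quadratic_relations x Q2 ->
  monomial_basis x S ->
  all S mu ->
  minimal_generators x mu ->
  ~ partial_ideal x mu r 1 ->
  linear_quotients x mu ->
  (forall i j, (i <= j < r)%N -> (mon_deg mu i <= mon_deg mu j)%N) ->
  (exists (E : nat -> {set 'I_n})
          (psi : forall j F d, 'M[A]_(rk (KE x mu Q2 E j) d, rk F d)),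
     cone_data gr psi) /\
  forall (E : nat -> {set 'I_n})
         (psi : forall j F d, 'M[A]_(rk (KE x mu Q2 E j) d, rk F d)),
    cone_data gr psi ->
    minimal_graded_free_resolution gr x (iterated_cone psi r) (partial_ideal x mu r) /\
    forall f : forall i l : nat, (\dim {: Bdual Q2 (E i) l}).-tuple (Bdual Q2 (E i) l),
      (forall i l, basis_of {: Bdual Q2 (E i) l} (f i l)) ->
      forall l,
        free_module_basis
          (fun p : {i : 'I_r & 'I_(\dim {: Bdual Q2 (E i) l})} =>
             cone_incl psi
               (pure_tensor 1 (tnth (f (tag p) l) (tagged p)) :
                  'rV[A]_(rk (KE x mu Q2 E (tag p)) l)) r).
Proof.
move=> sg [_ colon_var] rel2 _ _ mingen proper linquo deg_mono.
split=> [|E psi [colE lift_psi]]; first exact: cone_data_ex.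
split; last exact: iterated_cone_basis.
have [grF resF minF _ _ _] :
    cone_invariant gr x mu r (iterated_cone psi r) by apply: iterated_cone_invariant.
by split.
Qed.
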